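(* Let $K$ be a field of characteristic zero. For $a\in K\setminus\{-1,0,1/2,1,2\}$ let $$\begin{aligned} Q(a) ={}& 2ax^3y+ 4ax^2y^2+ 2axy^3 -(2a - 1)(a - 2)x^3z -(5a^2 - 17a + 5)x^2yz\\ & -3(a^2 - 4a + 1)xy^2z + ay^3z -3(2a - 1)(a - 2)x^2z^2 -(7a^2 - 19a + 7)xyz^2\\ & + 2ay^2z^2 -2(2a - 1)(a - 2)xz^3 +ayz^3 -2atx^2y-2atxy^2+ 2(2a - 1)(a - 2)tx^2z\\ & + 4(a^2 - 3a + 1)txyz -2aty^2z+ 2(2a - 1)(a - 2)txz^2 -2atyz^2 , \end{aligned}$$ and let $G_a\subseteq \mathrm{PGL}(4,K)$ be the stabiliser of the surface $Q(a)=0$. (1) If $a\in K\setminus\{-1,0,1/2,1,2\}$ is not a root of $x^2-x+1=0$, then $G_a$ is isomorphic to the symmetric group $S_3$ and is generated by (the classes of) the two matrices $$\begin{pmatrix}2 & 2 & 2 & 0 \\ 0 & -2 & 0 & 0 \\ -2 & 0 & 0 & 0 \\ 0 & 1 & 3 & -2\end{pmatrix},\qquad \begin{pmatrix}2 & 2 & 2 & 0 \\ 0 & -2 & 0 & 0 \\ 0 & 0 & -2 & 0 \\ 0 & -2 & -3 & 2\end{pmatrix}.$$ (2) If $a=\epsilon\in K$ is a solution of the equation $x^2-x+1=0$, then the surface $Q(\epsilon)=0$ has equation $Q'=0$, where $$\begin{aligned} Q' ={}& x^3y + 2x^2y^2 + xy^3 + \tfrac32x^3z + 6x^2yz + \tfrac92xy^2z+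 \tfrac12y^3z + \tfrac92x^2z^2 + 6xyz^2 + y^2z^2\\ & + 3xz^3 + \tfrac12yz^3 - x^2yt - xy^2t - 3x^2zt - 4xyzt - y^2zt - 3xz^2t - yz^2t , \end{aligned}$$ and its stabiliser $G_\epsilon$ has order $18$, is isomorphic to $S_3\times C_3$, and is generated by (the classes of) the two matrices $$\begin{pmatrix}2 & 2 & 2 & 0 \\ 0 & -2 & 0 & 0 \\ 0 & 0 & -2 & 0 \\ 0 & -2 & -3 & 2\end{pmatrix},\qquad \begin{pmatrix}0 & 2\epsilon - 2 & 2\epsilon - 4 & 0 \\ 0 & -4\epsilon + 2 & 0 & 0 \\ 2\epsilon - 4 & 2\epsilon - 2 & 0 & 0 \\ -3 & -3\epsilon & -3\epsilon & 4\epsilon - 2\end{pmatrix}.$$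
   Context: Homogeneous coordinates on $\mathbb{P}^3_K$ are $(x,y,z,t)$. The group $\mathrm{PGL}(4,K)$ acts on points by $\mathcal{M}\cdot R=\mathcal{M}\,{}^tR$ (column vectors) and on homogeneous polynomials by $\mathcal{M}\cdot F = F(\mathcal{M}^{-1}\cdot{}^t(x,y,z,t))$. The stabiliser of $Q(a)$ is $G_a=\{\mathcal{M}\in\mathrm{PGL}(4,K) \mid \mathcal{M}\cdot Q(a)=Q(a)\}$, where $\mathcal{M}\cdot Q(a)=Q(a)$ means that the two polynomials define the same surface, i.e. agree up to a nonzero scalar factor. $C_3$ denotes the cyclic group of order $3$. *)

(* Defs.v *)
From HB Require Import structures.
From mathcomp Require Import all_boot all_order all_fingroup all_algebra.
From mathcomp Require Import generic_quotient.
From mathcomp Require Import mpoly.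
From mathcomp Require Import ring.

Set Implicit Arguments.
Unset Strict Implicit.
Unset Printing Implicit Defensive.

Import GRing.Theory.
Local Open Scope ring_scope.
Local Open Scope quotient_scope.

(* MathComp's 'GL_n[R] requires a finite ring R, so the general linear and the
   projective linear groups of an arbitrary field are built here. *)
Record GL (K : fieldType) (n : nat) :=
  GLmx { GLval : 'M[K]_n; GLvalP : GLval \in unitmx }.

HB.instance Definition _ (K : fieldType) (n : nat) := [isSub for @GLval K n].
HB.instance Definition _ (K : fieldType) (n : nat) :=
  [Choice of GL K n by <:].

Section GLGroup.
Variables (K : fieldType) (n : nat).
Implicit Types A B C : GL K n.

Fact GL1_subproof : (1%:M : 'M[K]_n) \in unitmx.
Proof. exact: unitmx1. Qed.

Fact GLM_subproof A B : GLval A *m GLval B \in unitmx.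
Proof. by rewrite unitmx_mul !GLvalP. Qed.

Fact GLV_subproof A : invmx (GLval A) \in unitmx.
Proof. by rewrite unitmx_inv GLvalP. Qed.

Definition GL1 : GL K n := GLmx GL1_subproof.
Definition GLM A B : GL K n := GLmx (GLM_subproof A B).
Definition GLV A : GL K n := GLmx (GLV_subproof A).

Fact GLMA : associative GLM.
Proof. by move=> A B C; apply: val_inj; rewrite /= mulmxA. Qed.

Fact GL1M : left_id GL1 GLM.
Proof. by move=> A; apply: val_inj; rewrite /= mul1mx. Qed.

Fact GLM1 : right_id GL1 GLM.
Proof. by move=> A; apply: val_inj; rewrite /= mulmx1. Qed.

Fact GLVM : left_inverse GL1 GLV GLM.
Proof. by move=> A; apply: val_inj; rewrite /= mulVmx ?GLvalP. Qed.

Fact GLMV : right_inverse GL1 GLV GLM.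
Proof. by move=> A; apply: val_inj; rewrite /= mulmxV ?GLvalP. Qed.

HB.instance Definition _ := isGroup.Build (GL K n) GLMA GL1M GLM1 GLVM GLMV.

(* The two matrices span the same line of 'M[K]_n; see GLpropP. *)
Definition GLprop A B : bool := (mxvec (GLval A) == mxvec (GLval B))%MS.

Lemma GLpropP A B :
  reflect (exists2 c : K, c != 0 & GLval A = c *: GLval B) (GLprop A B).
Proof.
apply: (iffP eqmxP) => [eqAB | [c nz_c AB]]; last first.
  by rewrite AB linearZ; apply: eqmx_scale.
have /sub_rVP[c Ac] : (mxvec (GLval A) <= mxvec (GLval B))%MS by rewrite eqAB.
have {}Ac : GLval A = c *: GLval B.
  by apply: (can_inj mxvecK); rewrite Ac linearZ.
have [c0 | nz_c] := eqVneq c 0; last by exists c.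
(* c = 0: both matrices vanish, which for invertible ones means n = 0 *)
exists 1; rewrite ?oner_eq0 // scale1r.
have A0 : GLval A = 0 by rewrite Ac c0 scale0r.
have B0 : mxvec (GLval B) = 0.
  by apply/eqP; rewrite -mxrank_eq0 -eqAB A0 linear0 mxrank0.
by apply: (can_inj mxvecK); rewrite A0 B0 linear0.
Qed.

Fact GLprop_refl : reflexive GLprop.
Proof. by move=> A; apply/eqmxP. Qed.

Fact GLprop_sym : ssrbool.symmetric GLprop.
Proof. by move=> A B; rewrite /GLprop andbC. Qed.

Fact GLprop_trans : transitive GLprop.
Proof.
by move=> B A C /eqmxP AB /eqmxP BC; apply/eqmxP; apply: eqmx_trans AB BC.
Qed.

Canonical GLprop_equiv := EquivRel GLprop GLprop_refl GLprop_sym GLprop_trans.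

Definition PGL := {eq_quot GLprop}.

HB.instance Definition _ := Choice.on PGL.
HB.instance Definition _ := EqQuotient.on PGL.

Implicit Types g h : PGL.

Definition PGL1 : PGL := \pi_PGL (1%g : GL K n).
Definition PGLM g h : PGL := \pi_PGL (repr g * repr h)%g.
Definition PGLV g : PGL := \pi_PGL (repr g)^-1%g.

Lemma pi_PGLE A B :
  \pi_PGL A = \pi_PGL B <-> exists2 c : K, c != 0 & GLval A = c *: GLval B.
Proof.
split=> [/eqP | AB]; first by rewrite eqmodE => /GLpropP.
by apply/eqP; rewrite eqmodE; apply/GLpropP.
Qed.

Lemma pi_PGLM A B : PGLM (\pi_PGL A) (\pi_PGL B) = \pi_PGL (A * B)%g.
Proof.
have /pi_PGLE[c nz_c rA] := reprK (\pi_PGL A).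
have /pi_PGLE[d nz_d rB] := reprK (\pi_PGL B).
apply/pi_PGLE; exists (c * d); first by rewrite mulf_neq0.
by rewrite /= rA rB -scalemxAl -scalemxAr scalerA.
Qed.

Lemma pi_PGLV A : PGLV (\pi_PGL A) = \pi_PGL A^-1%g.
Proof.
have /pi_PGLE[c nz_c rA] := reprK (\pi_PGL A).
apply/pi_PGLE; exists c^-1; first by rewrite invr_eq0.
by rewrite /= rA invmxZ // unitmxZ ?unitfE ?GLvalP.
Qed.

Fact PGLMA : associative PGLM.
Proof.
elim/quotW=> A; elim/quotW=> B; elim/quotW=> C.
by rewrite (pi_PGLM B C) (pi_PGLM A B) (pi_PGLM A) (pi_PGLM (A * B)%g) mulgA.
Qed.

Fact PGL1M : left_id PGL1 PGLM.
Proof. by elim/quotW=> A; rewrite pi_PGLM mul1g. Qed.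

Fact PGLM1 : right_id PGL1 PGLM.
Proof. by elim/quotW=> A; rewrite pi_PGLM mulg1. Qed.

Fact PGLVM : left_inverse PGL1 PGLV PGLM.
Proof. by elim/quotW=> A; rewrite pi_PGLV pi_PGLM mulVg. Qed.

Fact PGLMV : right_inverse PGL1 PGLV PGLM.
Proof. by elim/quotW=> A; rewrite pi_PGLV pi_PGLM mulgV. Qed.

HB.instance Definition _ := isGroup.Build PGL PGLMA PGL1M PGLM1 PGLVM PGLMV.

(* The class of an invertible matrix; the identity if A is singular. *)
Definition pgl_class (A : 'M[K]_n) : PGL := \pi_PGL (insubd (1%g : GL K n) A).

Lemma pgl_classM (A B : 'M[K]_n) : A \in unitmx -> B \in unitmx ->
  (pgl_class A * pgl_class B)%g = pgl_class (A *m B).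
Proof.
move=> uA uB; rewrite /pgl_class [LHS]pi_PGLM; congr (\pi_PGL _).
have valE (C : 'M[K]_n) (uC : C \in unitmx) : GLval (insubd (1%g : GL K n) C) = C.
  exact: (insubdK _ uC).
by apply: val_inj; rewrite /= !valE // unitmx_mul uA.
Qed.

End GLGroup.

(* A . F = F (A^-1 . (x_1, ..., x_n)^T) *)
Definition mx_act (K : fieldType) (n : nat) (A : 'M[K]_n) (F : {mpoly K[n]}) :
    {mpoly K[n]} :=
  F \mPo [tuple \sum_(j < n) invmx A i j *: 'X_j | i < n].

Definition same_surface (K : fieldType) (n : nat) (F G : {mpoly K[n]}) : Prop :=
  exists2 c : K, c != 0 & F = c *: G.

(* For homogeneous F the condition does not depend on the representative A,
   since mx_act (c *: A) F is then a nonzero scalar multiple of mx_act A F. *)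
Definition stabiliser (K : fieldType) (n : nat) (F : {mpoly K[n]})
    (g : PGL K n) : Prop :=
  exists2 A : GL K n, \pi_(PGL K n) A = g &
    same_surface (mx_act (GLval A) F) F.

(* Subsets of a possibly infinite group are Prop-valued predicates: MathComp's
   {group gT} and <<_>> are restricted to finite groups. *)
Definition is_subgroup (G : groupType) (H : G -> Prop) : Prop :=
  H 1%g /\ (forall x y : G, H x -> H y -> H (x * y^-1)%g).

Definition generated (G : groupType) (S : seq G) (x : G) : Prop :=
  forall H : G -> Prop, is_subgroup H -> (forall s, s \in S -> H s) -> H x.

Definition is_generated_by (G : groupType) (H : G -> Prop) (S : seq G) : Prop :=
  forall x : G, H x <-> generated S x.

Definition isomorphic_to (G : groupType) (H : G -> Prop) (gT : groupType) :
    Prop :=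
  exists f : gT -> G,
    [/\ {morph f : u v / (u * v)%g >-> (u * v)%g}, injective f
      & forall x : G, H x <-> exists u : gT, f u = x].

Definition has_order (G : groupType) (H : G -> Prop) (m : nat) : Prop :=
  exists s : seq G,
    [/\ uniq s, size s = m & forall x : G, H x <-> x \in s].

Section Surface.
Variable K : fieldType.

Local Notation x := ('X_(@Ordinal 4 0 isT) : {mpoly K[4]}).
Local Notation y := ('X_(@Ordinal 4 1 isT) : {mpoly K[4]}).
Local Notation z := ('X_(@Ordinal 4 2 isT) : {mpoly K[4]}).
Local Notation t := ('X_(@Ordinal 4 3 isT) : {mpoly K[4]}).

Definition Q (a : K) : {mpoly K[4]} :=
  (2 * a) *: (x ^+ 3 * y) + (4 * a) *: (x ^+ 2 * y ^+ 2)
  + (2 * a) *: (x * y ^+ 3)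
  - ((2 * a - 1) * (a - 2)) *: (x ^+ 3 * z)
  - (5 * a ^+ 2 - 17 * a + 5) *: (x ^+ 2 * y * z)
  - (3 * (a ^+ 2 - 4 * a + 1)) *: (x * y ^+ 2 * z)
  + a *: (y ^+ 3 * z)
  - (3 * (2 * a - 1) * (a - 2)) *: (x ^+ 2 * z ^+ 2)
  - (7 * a ^+ 2 - 19 * a + 7) *: (x * y * z ^+ 2)
  + (2 * a) *: (y ^+ 2 * z ^+ 2)
  - (2 * (2 * a - 1) * (a - 2)) *: (x * z ^+ 3)
  + a *: (y * z ^+ 3)
  - (2 * a) *: (t * x ^+ 2 * y) - (2 * a) *: (t * x * y ^+ 2)
  + (2 * (2 * a - 1) * (a - 2)) *: (t * x ^+ 2 * z)
  + (4 * (a ^+ 2 - 3 * a + 1)) *: (t * x * y * z)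
  - (2 * a) *: (t * y ^+ 2 * z)
  + (2 * (2 * a - 1) * (a - 2)) *: (t * x * z ^+ 2)
  - (2 * a) *: (t * y * z ^+ 2).

Definition Q' : {mpoly K[4]} :=
  x ^+ 3 * y + 2 *: (x ^+ 2 * y ^+ 2) + x * y ^+ 3
  + (3 / 2) *: (x ^+ 3 * z) + 6 *: (x ^+ 2 * y * z)
  + (9 / 2) *: (x * y ^+ 2 * z) + (1 / 2) *: (y ^+ 3 * z)
  + (9 / 2) *: (x ^+ 2 * z ^+ 2) + 6 *: (x * y * z ^+ 2) + y ^+ 2 * z ^+ 2
  + 3 *: (x * z ^+ 3) + (1 / 2) *: (y * z ^+ 3)
  - x ^+ 2 * y * t - x * y ^+ 2 * t - 3 *: (x ^+ 2 * z * t)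
  - 4 *: (x * y * z * t) - y ^+ 2 * z * t - 3 *: (x * z ^+ 2 * t)
  - y * z ^+ 2 * t.

Definition mx_of_rows (rows : seq (seq K)) : 'M[K]_4 :=
  \matrix_(i, j) nth 0 (nth [::] rows i) j.

Definition M1 : 'M[K]_4 := mx_of_rows
  [:: [::  2;  2; 2;  0];
      [::  0; -2; 0;  0];
      [:: -2;  0; 0;  0];
      [::  0;  1; 3; -2]].

Definition M2 : 'M[K]_4 := mx_of_rows
  [:: [:: 2;  2;  2; 0];
      [:: 0; -2;  0; 0];
      [:: 0;  0; -2; 0];
      [:: 0; -2; -3; 2]].

Definition M3 (e : K) : 'M[K]_4 := mx_of_rows
  [:: [::         0;  2 * e - 2;  2 * e - 4;         0];
      [::         0; - 4 * e + 2;         0;         0];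
      [:: 2 * e - 4;  2 * e - 2;          0;         0];
      [::       - 3;  - 3 * e;      - 3 * e; 4 * e - 2]].

(* M1, M2 and M3 e are invertible wherever pgl_class is applied to them. *)
Fact mul_scalar_unitmx (A : 'M[K]_4) (c : K) (B : 'M[K]_4) :
  c != 0 -> A *m B = c%:M -> A \in unitmx.
Proof.
move=> nz_c AB; have: A *m (c^-1 *: B) = 1%:M.
  by rewrite -scalemxAr AB scale_scalar_mx mulVf.
by move/mulmx1_unit=> [].
Qed.

Fact pchar0_neq0 (m : nat) : [pchar K] =i pred0 -> m.+1%:R != 0 :> K.
Proof. by move/pcharf0P=> ->. Qed.

Fact M1_unit : [pchar K] =i pred0 -> M1 \in unitmx.
Proof.
move=> charK.
apply: (@mul_scalar_unitmx _ 4 (mx_of_rows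
  [:: [:: 0;  0; - 2;  0];
      [:: 0; - 2; 0;  0];
      [:: 2;  2; 2;  0];
      [:: 3; 2; 3; - 2]])).
  exact: (pchar0_neq0 3).
apply/matrixP=> i j; rewrite !mxE !big_ord_recl big_ord0 !mxE.
by case: i => [[|[|[|[|//]]]] ?]; case: j => [[|[|[|[|//]]]] ?]; rewrite /=;
  ring.
Qed.

Fact M2_unit : [pchar K] =i pred0 -> M2 \in unitmx.
Proof.
move=> charK.
apply: (@mul_scalar_unitmx _ 4 M2).
  exact: (pchar0_neq0 3).
apply/matrixP=> i j; rewrite !mxE !big_ord_recl big_ord0 !mxE.
by case: i => [[|[|[|[|//]]]] ?]; case: j => [[|[|[|[|//]]]] ?]; rewrite /=;
  ring.
Qed.

Fact M3_unit (e : K) :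
  [pchar K] =i pred0 -> e ^+ 2 - e + 1 = 0 -> M3 e \in unitmx.
Proof.
move=> charK e_root; pose u := 2 * e - 2; pose v := 2 * e - 4.
pose s := 4 * e - 2.
apply: (@mul_scalar_unitmx _ (v * s ^+ 2) (mx_of_rows
  [:: [:: 0; u * s; s ^+ 2; 0];
      [:: 0; - (v * s); 0; 0];
      [:: s ^+ 2; u * s; 0; 0];
      [:: 3 * e * s; 3 * u - 3 * e * v + 3 * e * u; 3 * s; v * s]])).
  apply: mulf_neq0.
    apply: contra_neq (pchar0_neq0 5 charK) => v0.
    have -> : 6 = 2 * (e ^+ 2 - e + 1) - (e + 1) * v :> K by rewrite /v; ring.
    by rewrite e_root v0; ring.
  apply: contra_neq (pchar0_neq0 11 charK) => s0.
  have -> : 12 = 16 * (e ^+ 2 - e + 1) - s ^+ 2 :> K by rewrite /s; ring.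
  by rewrite e_root s0; ring.
apply/matrixP=> i j; rewrite !mxE !big_ord_recl big_ord0 !mxE.
by case: i => [[|[|[|[|//]]]] ?]; case: j => [[|[|[|[|//]]]] ?];
  rewrite /= /u /v /s; ring.
Qed.

End Surface.

(* Main.v *)
Require Import Defs.
From mathcomp Require Import all_boot all_fingroup all_algebra.
From mathcomp Require Import mpoly ring.

(** In the coordinates x, z, w = -(x + y + z) and T = 4t - 2x - 3y - 4z the
    quartic becomes, up to the factor -a/2, the normal form
      N = T F - e1 V,  with  F = e1 e2 - c e3,
    where e1, e2, e3 are the elementary symmetric polynomials of x, z, w, V is
    their Vandermonde determinant and a c = -(2a - 1)(a - 2)
    ([quartic_nform]).  The excluded values of a other than 0 are those with
    c = 0, 1 or 9, the values for which the plane cubic F = 0 is singular.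
    Permuting x, z, w and letting T change by the sign of the permutation
    preserves N up to sign: this is the copy of S_3.
    When c = 3, which means a^2 - a + 1 = 0, the cubic F only involves e1^3 and
    the differences of the coordinates, so that e1 and T may moreover be
    multiplied by a cube root of unity ([nform_sym]).

    Conversely let B be a linear map preserving N up to a factor
    ([nform_similitude]).
    - The point x = z = w = 0 is the only triple point of the surface, because
      the cubic F is smooth; so B fixes it, and acts on the plane of x, z, w
      by a map A that preserves F up to a factor and e1 V modulo F and up to a
      factor ([nform_block]).
    - The plane cubic F = 0 meets the four lines e1 V = 0 in twelve points
      (over an algebraic closure), among which only (0, 1, -1), (-1, 0, 1) and
      (1, -1, 0) are flexes ([flex_on_lines]).  Hence A permutes these three
      points, and after composition with a permutation of the coordinates it
      fixes each of them.
    - The three flexes are collinear and satisfy a linear relation, so A is then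
      scalar on the line e1 = 0.  Comparing the coefficients of F determines
      the rest of A ([cubic_diag]), and the remainder e1 V determines the
      action on T ([nform_diag]).

    No root of F has to be computed, so the argument works over K itself.  The
    stabiliser is thus parametrised by S_3, or by S_3 times the cube roots of
    unity 1, -a, a^2 when c = 3; identifying the given matrices with such
    parameters reduces generation to a computation in S_3 or S_3 x C_3. *)

Set Implicit Arguments.
Unset Strict Implicit.
Unset Printing Implicit Defensive.

Import GRing.Theory.
Local Open Scope ring_scope.

(** * The normal form *)

Lemma mulf_eq0I (R : idomainType) (x y : R) : x != 0 -> x * y = 0 -> y = 0.
Proof. by move=> nz_x /eqP; rewrite mulf_eq0 (negPf nz_x) => /eqP. Qed.

Section NormalForm.
Variable R : comNzRingType.
Implicit Types (c T : R) (u : 'cV[R]_3) (v : 'cV[R]_(3 + 1)).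

Definition csum u : R := \sum_i u i 0.
Definition vdm u : R := \det (Vandermonde 3 u^T).
(** e1 e2 - c e3, with e2 written as a sum of products over the complements of
    single indices, so that its symmetry is a reindexing. *)
Definition cubic c u : R :=
  csum u * (\sum_i \prod_(j | j != i) u j 0) - c * \prod_i u i 0.
Definition nform c v : R :=
  dsubmx v 0 0 * cubic c (usubmx v) - csum (usubmx v) * vdm (usubmx v).

Lemma sum3 (f : 'I_3 -> R) : \sum_i f i = f 0 + f 1 + f 2.
Proof.
rewrite !big_ord_recl big_ord0 addr0 addrA.
by congr (f _ + f _ + f _); apply: val_inj.
Qed.

Lemma prod3 (f : 'I_3 -> R) : \prod_i f i = f 0 * f 1 * f 2.
Proof.
rewrite !big_ord_recl big_ord0 mulr1 mulrA.
by congr (f _ * f _ * f _); apply: val_inj.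
Qed.

Lemma csumE u : csum u = u 0 0 + u 1 0 + u 2 0.
Proof. exact: sum3. Qed.

Lemma cubicE c u : cubic c u =
  (u 0 0 + u 1 0 + u 2 0)
    * (u 0 0 * u 1 0 + u 0 0 * u 2 0 + u 1 0 * u 2 0)
  - c * (u 0 0 * u 1 0 * u 2 0).
Proof.
rewrite /cubic csumE sum3 prod3.
have prodN1 (i : 'I_3) : \prod_(j | j != i) u j 0 =
    (if 0 != i then u 0 0 else 1) * (if 1 != i then u 1 0 else 1)
    * (if 2 != i then u 2 0 else 1).
  by rewrite big_mkcond prod3.
rewrite !prodN1 /=; ring.
Qed.

Lemma vdmE u : vdm u = (u 0 0 - u 1 0) * (u 1 0 - u 2 0) * (u 2 0 - u 0 0).
Proof.
rewrite /vdm det_Vandermonde prod3 !(big_mkcond (fun j : 'I_3 => _ < j)%N).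
rewrite !prod3 /= !mxE; ring.
Qed.

Lemma csum_perm (s : 'S_3) u : csum (row_perm s u) = csum u.
Proof.
rewrite /csum [RHS](reindex_perm s) /=.
by apply: eq_bigr => i _; rewrite mxE.
Qed.

Lemma cubic_perm c (s : 'S_3) u : cubic c (row_perm s u) = cubic c u.
Proof.
rewrite /cubic csum_perm; congr (_ * _ - _ * _).
  rewrite [RHS](reindex_perm s) /=; apply: eq_bigr => i _.
  rewrite [RHS](reindex_perm s) /=.
  by apply: eq_big => [j | j _]; rewrite ?(inj_eq perm_inj) ?mxE.
by rewrite [RHS](reindex_perm s) /=; apply: eq_bigr => i _; rewrite mxE.
Qed.

(** Permuting the variables permutes the columns of the Vandermonde matrix. *)
Lemma vdm_perm (s : 'S_3) u : vdm (row_perm s u) = (-1) ^+ s * vdm u.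
Proof.
have -> : vdm (row_perm s u) = \det (col_perm s (Vandermonde 3 u^T)).
  by congr (\det _); apply/matrixP => i j; rewrite !mxE.
by rewrite col_permE det_mulmx det_perm odd_permV mulrC.
Qed.

(** For c = 3 the cubic is 2/9 e1^3 plus a function of the differences of the
    coordinates, and a shift along (1, 1, 1) only changes the first part. *)
Lemma cubic3_shift b u : cubic 3 (u + const_mx (b * csum u)) =
  cubic 3 u + 2 * (b + 3 * b ^+ 2 + 3 * b ^+ 3) * csum u ^+ 3.
Proof.
rewrite !cubicE !mxE csumE; move: (u 0 0) (u 1 0) (u 2 0) => x y z; ring.
Qed.

End NormalForm.

(** * Symmetries of the normal form *)

(** The possible ratios between the factor of a symmetry on e1 and its factor on
    the differences of the coordinates. *)
Definition admissible (K : fieldType) (c w : K) : Prop :=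
  w = 1 \/ c = 3 /\ w ^+ 3 = 1.

Lemma admissible_neq0 (K : fieldType) (c w : K) : admissible c w -> w != 0.
Proof.
case=> [-> | [_ w3]]; first exact: oner_neq0.
by apply: contra_eq_neq w3 => ->; rewrite expr0n eq_sym oner_neq0.
Qed.

Lemma admissibleV (K : fieldType) (c w : K) :
  admissible c w -> admissible c w^-1.
Proof.
case=> [-> | [c3 w3]]; first by left; rewrite invr1.
by right; rewrite exprVn w3 invr1.
Qed.

Lemma third_ord (i k : 'I_3) : exists j, (j != i) && (j != k).
Proof.
by case: i => [[|[|[|//]]] ?]; case: k => [[|[|[|//]]] ?];
  first [by exists 0 | by exists 1 | by exists 2].
Qed.

Section SymMx.
Variable K : fieldType.
Hypothesis three_neq0 : 3 != 0 :> K.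
Implicit Types (s : 'S_3) (w c : K).

(** On the plane: the permutation s of the coordinates, composed with the map
    that multiplies e1 by w and preserves the differences of the coordinates. *)
Definition sym_mx s w : 'M[K]_(3 + 1) :=
  block_mx (perm_mx s + const_mx ((w - 1) / 3)) 0 0 ((-1) ^+ s * w)%:M.

Lemma sym_mxM s w s' w' :
  sym_mx s w *m sym_mx s' w' = sym_mx (s * s')%g (w * w').
Proof.
rewrite mulmx_block !mul0mx !mulmx0 !addr0 !add0r; congr block_mx; last first.
  by rewrite -scalar_mxM odd_permM signr_addb mulrACA.
rewrite mulmxDl !mulmxDr -perm_mxM -!addrA; congr (_ + _).
have permJ (t : 'S_3) (b : K) : perm_mx t *m const_mx b = const_mx b :> 'M_3.
  by rewrite -row_permE; apply/matrixP => i j; rewrite !mxE.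
have Jperm (t : 'S_3) (b : K) : const_mx b *m perm_mx t = const_mx b :> 'M_3.
  by rewrite -[t]invgK -col_permE; apply/matrixP => i j; rewrite !mxE.
rewrite permJ Jperm; apply/matrixP => i j; rewrite !mxE sum3 !mxE; by field.
Qed.

Lemma sym_mx1 : sym_mx 1 1 = 1%:M.
Proof.
rewrite /sym_mx perm_mx1 subrr mul0r odd_perm1 expr0 mul1r.
by rewrite [const_mx 0]/(0 : 'M_3) addr0 -scalar_mx_block.
Qed.

Lemma sym_mx_unit s w : w != 0 -> sym_mx s w \in unitmx.
Proof.
move=> nz_w; suff /mulmx1_unit[] : sym_mx s w *m sym_mx s^-1 w^-1 = 1%:M by [].
by rewrite sym_mxM mulgV mulfV ?sym_mx1.
Qed.

Lemma sym_mxV s w : w != 0 -> invmx (sym_mx s w) = sym_mx s^-1 w^-1.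
Proof.
move=> nz_w; have u := sym_mx_unit s nz_w.
by rewrite -[LHS]mulmx1 -sym_mx1 -(mulgV s) -(mulfV nz_w) -sym_mxM mulKmx.
Qed.

(** Off the diagonal a scalar matrix vanishes, whereas in a row moved by the
    permutation a permutation matrix plus a constant takes two distinct values
    off the diagonal. *)
Lemma sym_mx_inj s w s' w' k : k != 0 -> w' != 0 ->
  sym_mx s w = k *: sym_mx s' w' -> s = s' /\ w = w'.
Proof.
move=> nz_k nz_w' eq_sw.
have {eq_sw} : sym_mx (s * s'^-1)%g (w / w') = k%:M.
  rewrite -sym_mxM eq_sw -scalemxAl -sym_mxV //.
  by rewrite mulmxV ?sym_mx_unit ?scalemx1.
set t := (s * s'^-1)%g; set z := w / w' => eq_tz.
suff [t1 z1] : t = 1%g /\ z = 1.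
  split; first by apply: (mulIg s'^-1%g); rewrite mulgV.
  by apply: (mulIf (invr_neq0 nz_w')); rewrite mulfV.
have entry i j : ((t i == j)%:R + (z - 1) / 3 : K) = k *+ (i == j).
  move/matrixP/(_ (lshift 1 i) (lshift 1 j)): eq_tz.
  by rewrite block_mxEul !mxE eq_lshift.
have t1 : t = 1%g.
  apply/permP => i; rewrite perm1; apply/eqP/negPn/negP => ti.
  (* an entry off the diagonal where the permutation matrix vanishes *)
  have [j /andP[ij tij]] := third_ord i (t i).
  have := entry i (t i); have := entry i j.
  rewrite eqxx ![_ == j]eq_sym (negPf tij) (negPf ij) [i == _]eq_sym.
  rewrite (negPf ti) /= !mulr0n add0r => -> /eqP.
  by rewrite addr0 oner_eq0.
split=> //; have := entry 0 1; have := entry 0 0.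
move/matrixP/(_ (rshift 3 0) (rshift 3 0)): eq_tz.
rewrite block_mxEdr !mxE eq_rshift t1 odd_perm1 mul1r !perm1 /=.
rewrite !add0r !mulr1n !mulr0n => -> _ /eqP.
by rewrite mulf_eq0 invr_eq0 (negPf three_neq0) orbF subr_eq0 => /eqP.
Qed.

(** Stated over every commutative K-algebra, so as to apply both to points and
    to the generic point of the space, whose coordinates are polynomials. *)
Lemma nform_sym (R : comNzRingType) (f : {rmorphism K -> R}) c s w
    (v : 'cV[R]_(3 + 1)) :
    admissible c w ->
  nform (f c) (map_mx f (sym_mx s w) *m v) = f ((-1) ^+ s * w) * nform (f c) v.
Proof.
move=> w3; rewrite -[v]vsubmxK; move: (usubmx v) (dsubmx v) => u T {v}.
rewrite map_block_mx !raddf0 mul_block_col !mul0mx addr0 add0r.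
rewrite /nform !col_mxKu !col_mxKd map_scalar_mx mul_scalar_mx mxE /=.
set u' := (_ *m u); pose b := (w - 1) / 3.
have wE : w = 1 + 3 * b by rewrite /b; field.
have u'E : u' = row_perm s u + const_mx (f b * csum u).
  rewrite /u' map_mxD mulmxDl map_perm_mx -row_permE; congr (_ + _).
  by apply/matrixP => i j; rewrite !mxE ord1 csumE sum3 !mxE -!mulrDr.
have e1 : csum u' = f w * csum u.
  have -> : f w = 1 + 3 * f b.
    by rewrite {1}wE rmorphD rmorphM rmorph1 rmorph_nat.
  by rewrite u'E -(csum_perm s u) !csumE !mxE; ring.
have vd : vdm u' = (-1) ^+ s * vdm u.
  rewrite -vdm_perm u'E !vdmE !mxE; ring.
have cub : cubic (f c) u' = cubic (f c) u.
  rewrite -(cubic_perm _ s u) u'E; case: w3 => [w1 | [-> w3]].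
    by rewrite /b w1 subrr mul0r rmorph0 mul0r [const_mx 0]/(0 : 'cV_3) addr0.
  have fb : f b + 3 * f b ^+ 2 + 3 * f b ^+ 3 = 0.
    suff b3 : b + 3 * b ^+ 2 + 3 * b ^+ 3 = 0.
      by have := congr1 f b3; rewrite rmorph0 !rmorphD !(rmorphM, rmorph_nat).
    apply: (mulfI three_neq0); apply: (mulfI three_neq0); rewrite !mulr0.
    transitivity (w ^+ 3 - 1); last by rewrite w3 subrr.
    by rewrite wE; ring.
  by rewrite rmorph_nat -(csum_perm s u) cubic3_shift fb mulr0 mul0r addr0.
rewrite e1 vd cub rmorphM rmorphXn rmorphN1; move: (_ ^+ s) => sgn; ring.
Qed.

End SymMx.

(** * Smoothness and flexes of the cubic *)

Section Curve.
Variable K : fieldType.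
Hypotheses (two_neq0 : 2 != 0 :> K) (three_neq0 : 3 != 0 :> K).
Variable c : K.
Hypotheses (c_neq0 : c != 0) (c_neq1 : c != 1) (c_neq9 : c != 9).
Implicit Types (x y z w : K) (u v d : 'cV[K]_3).

Definition cubic_xyz x y z : K :=
  (x + y + z) * (x * y + x * z + y * z) - c * (x * y * z).

(** The partial derivative of [cubic_xyz] in its first variable. *)
Definition cubic_dx x y z : K :=
  (x * y + x * z + y * z) + (x + y + z) * (y + z) - c * (y * z).

Lemma cubic_smooth_diag x w :
  cubic_dx x x w = 0 -> cubic_dx w x x = 0 -> x = 0 /\ w = 0.
Proof.
move=> gx gw.
have /eqP : (w - x) * (2 * x + w - c * x) = 0.
  transitivity (cubic_dx x x w - cubic_dx w x x); last by rewrite gx gw subrr.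
  rewrite /cubic_dx; ring.
rewrite mulf_eq0 !subr_eq0 => /orP[/eqP wx | /eqP wx].
  suff : x = 0 by rewrite wx => ->.
  suff /eqP : x ^+ 2 = 0 by rewrite sqrf_eq0 => /eqP.
  apply: (@mulf_eq0I _ (9 - c)); first by rewrite subr_eq0 eq_sym.
  by rewrite -gx wx /cubic_dx; ring.
have {}wx : w = (c - 2) * x by rewrite mulrBl -wx; ring.
suff x0 : x = 0 by rewrite wx x0 mulr0.
suff /eqP : x ^+ 2 = 0 by rewrite sqrf_eq0 => /eqP.
apply: (@mulf_eq0I _ (3 * (c - 1))); first by rewrite mulf_neq0 // subr_eq0.
by rewrite -gx wx /cubic_dx; ring.
Qed.

(** The difference of two partial derivatives splits into linear factors, so a
    singular point has two equal coordinates. *)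
Lemma cubic_smooth x y z :
  cubic_dx x y z = 0 -> cubic_dx y z x = 0 -> cubic_dx z x y = 0 ->
  [/\ x = 0, y = 0 & z = 0].
Proof.
have rot a b e : cubic_dx a b e = cubic_dx a e b by rewrite /cubic_dx; ring.
have [-> | xy] := eqVneq x y.
  by move=> gy _ gz; have [-> ->] := cubic_smooth_diag gy gz.
have [-> | yz] := eqVneq y z.
  rewrite rot => gx; rewrite rot => gz _.
  by have [-> ->] := cubic_smooth_diag gz gx.
have [-> | zx] := eqVneq z x.
  by move=> _ gy gx; have [-> ->] := cubic_smooth_diag gx gy.
move=> gx gy gz.
have sx : x + y + z = c * x.
  apply/eqP; rewrite -subr_eq0; apply/eqP; apply: (@mulf_eq0I _ (y - z)).
    by rewrite subr_eq0.
  transitivity (cubic_dx z x y - cubic_dx y z x); last by rewrite gz gy subrr.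
  by rewrite /cubic_dx; ring.
have sy : x + y + z = c * y.
  apply/eqP; rewrite -subr_eq0; apply/eqP; apply: (@mulf_eq0I _ (x - z)).
    by rewrite subr_eq0 eq_sym.
  transitivity (cubic_dx z x y - cubic_dx x y z); last by rewrite gz gx subrr.
  by rewrite /cubic_dx; ring.
by case/eqP: xy; apply: (mulfI c_neq0); rewrite -sx.
Qed.

(** A point with two equal coordinates is fixed by a transposition, and so is
    its tangent, which therefore contains (1, -1, 0); the tangency is then of
    order exactly two.  So a direction in which the cubic has contact of order
    three can only be a multiple of the point itself. *)
Lemma flex_on_mirror x w (d0 d1 d2 k : K) :
  (x != 0) || (w != 0) ->
  (forall r, cubic_xyz (x + r * d0) (x + r * d1) (w + r * d2) = k * r ^+ 3) ->
  exists g, [/\ d0 = g * x, d1 = g * x & d2 = g * w].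
Proof.
move=> nz_p flex.
have F0 : cubic_xyz x x w = 0.
  by have := flex 0; rewrite !mul0r !addr0 expr0n mulr0.
pose g0 := cubic_dx x x w; pose g2 := cubic_dx w x x.
pose f2 := (2 * x + w) * (d0 * d1 + d0 * d2 + d1 * d2)
  + (d0 + d1 + d2) * (x * d1 + d0 * x + x * d2 + d0 * w + x * d2 + d1 * w)
  - c * (x * d1 * d2 + d0 * x * d2 + d0 * d1 * w).
have expand r : k * r ^+ 3 =
    (g0 * (d0 + d1) + g2 * d2) * r + f2 * r ^+ 2 + cubic_xyz d0 d1 d2 * r ^+ 3.
  rewrite -flex -[LHS]subr0 -F0 /f2 /g0 /g2 /cubic_xyz /cubic_dx; ring.
(* compare the values at 1, -1 and 2 *)
have f2_0 : f2 = 0.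
  apply: (mulf_eq0I two_neq0).
  transitivity (k * 1 ^+ 3 + k * (-1) ^+ 3); last by ring.
  rewrite !expand; ring.
have f1_0 : g0 * (d0 + d1) + g2 * d2 = 0.
  have E1 := expand 1; have E2 := expand 2; rewrite f2_0 in E1 E2.
  apply: (mulf_eq0I (mulf_neq0 two_neq0 three_neq0)).
  transitivity (8 * (k * 1 ^+ 3) - k * 2 ^+ 3); last by ring.
  rewrite E1 E2; ring.
have euler : 2 * x * g0 + w * g2 = 0.
  transitivity (3 * cubic_xyz x x w); last by rewrite F0 mulr0.
  rewrite /g0 /g2 /cubic_xyz /cubic_dx; ring.
have cross : (d0 + d1) * w = 2 * x * d2.
  apply/eqP; rewrite -subr_eq0; apply/eqP.
  have [z_g0 | nz_g0] := eqVneq g0 0; last first.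
    apply: (mulf_eq0I nz_g0).
    transitivity (w * (g0 * (d0 + d1) + g2 * d2) - d2 * (2 * x * g0 + w * g2)).
      by ring.
    by rewrite f1_0 euler; ring.
  have [z_g2 | nz_g2] := eqVneq g2 0.
    have [x0 w0] := cubic_smooth_diag z_g0 z_g2.
    by rewrite x0 w0 eqxx in nz_p.
  apply: (mulf_eq0I nz_g2).
  transitivity ((d0 + d1) * (2 * x * g0 + w * g2)
    - 2 * x * (g0 * (d0 + d1) + g2 * d2)); first by ring.
  by rewrite f1_0 euler; ring.
pose e := (d0 - d1) / 2.
(* the tangent is spanned by the point and by (1, -1, 0) *)
have [g [d0E d1E d2E]] :
    exists g, [/\ d0 = g * x + e, d1 = g * x - e & d2 = g * w].
  have [x0 | nz_x] := eqVneq x 0.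
    move: nz_p cross; rewrite x0 eqxx /= => nz_w.
    rewrite mulr0 mul0r => /eqP.
    rewrite mulf_eq0 (negPf nz_w) orbF addr_eq0 => /eqP d01.
    by exists (d2 / w); rewrite /e d01; split; field; rewrite ?two_neq0 ?nz_w.
  exists ((d0 + d1) / (2 * x)); rewrite /e; split.
  - by field; rewrite two_neq0 nz_x.
  - by field; rewrite two_neq0 nz_x.
  apply: (mulfI (mulf_neq0 two_neq0 nz_x)); rewrite -cross.
  by field; rewrite two_neq0 nz_x.
have : e ^+ 2 * ((c - 1) * w - 2 * x) = 0.
  transitivity (f2 - 3 * g ^+ 2 * cubic_xyz x x w); last first.
    by rewrite f2_0 F0; ring.
  rewrite /f2 d0E d1E d2E /cubic_xyz; ring.
move/eqP; rewrite mulf_eq0 sqrf_eq0 => /orP[/eqP e0 | ].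
  by exists g; rewrite d0E d1E d2E e0 addr0 subr0.
rewrite subr_eq0 => /eqP xw.
suff w0 : w = 0.
  move: nz_p; rewrite w0 eqxx orbF => /(mulf_neq0 two_neq0).
  by rewrite -xw w0 mulr0 eqxx.
have /eqP : (2 * x) * (4 * c * w ^+ 2) = 0.
  transitivity (4 * cubic_xyz x x w); last by rewrite F0 mulr0.
  have -> : 4 * cubic_xyz x x w =
    (2 * x) * ((2 * x) ^+ 2 + (5 - c) * (2 * x) * w + 4 * w ^+ 2).
    rewrite /cubic_xyz; ring.
  rewrite -xw; ring.
rewrite -xw !mulf_eq0 (negPf c_neq0) subr_eq0 (negPf c_neq1) /=.
have -> : (4 == 0 :> K) = false.
  by apply/negbTE; rewrite (_ : 4 = 2 * 2) ?mulf_neq0 //; ring.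
by rewrite /= !orbb => /eqP.
Qed.

Lemma col3P u v : u 0 0 = v 0 0 -> u 1 0 = v 1 0 -> u 2 0 = v 2 0 -> u = v.
Proof.
move=> E0 E1 E2; apply/matrixP => i j; rewrite ord1.
by case: i => [[|[|[|//]]] lt_i]; [move: E0 | move: E1 | move: E2];
  congr (u _ _ = v _ _); apply: val_inj.
Qed.

(** The points (0, 1, -1), (-1, 0, 1), (1, -1, 0) where the line e1 = 0 meets
    the cubic. *)
Definition flex_pt (i : 'I_3) : 'cV[K]_3 :=
  \col_j ((j == i + 1)%:R - (j == i + 2)%:R).

Lemma ord3_ind (P : 'I_3 -> Prop) : P 0 -> P 1 -> P 2 -> forall i, P i.
Proof.
move=> P0 P1 P2 [[|[|[|//]]] lt_i];
  [move: P0 | move: P1 | move: P2]; congr P; exact: val_inj.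
Qed.

Lemma flex_ptE :
  ((flex_pt 0 0 0 = 0) * (flex_pt 0 1 0 = 1) * (flex_pt 0 2 0 = -1)
  * (flex_pt 1 0 0 = -1) * (flex_pt 1 1 0 = 0) * (flex_pt 1 2 0 = 1)
  * (flex_pt 2 0 0 = 1) * (flex_pt 2 1 0 = -1) * (flex_pt 2 2 0 = 0))%type.
Proof. by do !split; rewrite mxE /= ?subrr ?subr0 ?sub0r. Qed.

Lemma multiple_flex_pt u i :
  csum u = 0 -> u i 0 = 0 -> exists a, u = a *: flex_pt i.
Proof.
rewrite csumE; elim/ord3_ind: i => + ui; rewrite ui ?addr0 ?add0r => /eqP;
  rewrite addr_eq0 => /eqP E;
  [exists (u 1 0) | exists (u 2 0) | exists (u 0 0)];
  by apply: col3P; rewrite ?ui ?E [RHS]mxE !flex_ptE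
    ?mulr1 ?mulrN1 ?mulr0 ?opprK.
Qed.

Lemma csum_flex_pt i : csum (flex_pt i) = 0.
Proof. by rewrite csumE; elim/ord3_ind: i; rewrite !flex_ptE; ring. Qed.

Lemma flex_pt_neq0 i : flex_pt i != 0.
Proof.
apply/eqP => /matrixP/(_ (i + 1) 0) /eqP.
by elim/ord3_ind: i; rewrite !mxE /= ?subr0 oner_eq0.
Qed.

(** A flex is a point with a line u + r d through it that meets the cubic there
    with multiplicity at least three. *)
Definition flex u : Prop :=
  u != 0 /\ exists d, (forall g, d <> g *: u) /\
    exists k, forall r, cubic c (u + r *: d) = k * r ^+ 3.

Lemma flex_ptP i : flex (flex_pt i).
Proof.
split; first exact: flex_pt_neq0.
(* a direction of the tangent, (c - 1) x = z + w for the first of the points *)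
exists (\col_j ((j == i)%:R + (c - 1) * (j == i + 1)%:R)); split=> [g|].
  move=> /matrixP/(_ i 0)/eqP; rewrite !mxE.
  by elim/ord3_ind: i; rewrite /= ?subrr ?mulr0 ?addr0 oner_eq0.
exists (c * (c - 1)) => r.
by elim/ord3_ind: i; rewrite cubicE !mxE /=; ring.
Qed.

Lemma flex_on_lines u :
  flex u -> csum u * vdm u = 0 -> exists i a, u = a *: flex_pt i.
Proof.
move=> [nz_u [d [nprop [k tang]]]] /eqP; rewrite mulf_eq0 => /orP[/eqP e0 | ].
  have : cubic c u = 0 by have := tang 0; rewrite scale0r addr0 expr0n mulr0.
  rewrite cubicE -csumE e0 mul0r sub0r => /eqP.
  rewrite oppr_eq0 !mulf_eq0 (negPf c_neq0) /=.
  case/orP => [/orP[] | ] /eqP ui;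
    by have [a uE] := multiple_flex_pt e0 ui; eexists _, a; apply: uE.
have tangE r : (u 0 0 + r * d 0 0 + (u 1 0 + r * d 1 0) + (u 2 0 + r * d 2 0))
    * ((u 0 0 + r * d 0 0) * (u 1 0 + r * d 1 0)
      + (u 0 0 + r * d 0 0) * (u 2 0 + r * d 2 0)
      + (u 1 0 + r * d 1 0) * (u 2 0 + r * d 2 0))
    - c * ((u 0 0 + r * d 0 0) * (u 1 0 + r * d 1 0) * (u 2 0 + r * d 2 0))
    = k * r ^+ 3.
  by rewrite -tang cubicE !mxE.
have nz3 : u 0 0 <> 0 \/ u 1 0 <> 0 \/ u 2 0 <> 0.
  have [u0 | ] := eqVneq (u 0 0) 0; last by move/eqP; left.
  have [u1 | ] := eqVneq (u 1 0) 0; last by move/eqP; right; left.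
  have [u2 | ] := eqVneq (u 2 0) 0; last by move/eqP; right; right.
  by case/eqP: nz_u; apply: col3P; rewrite mxE.
have nz_or (x w : K) : x <> 0 \/ w <> 0 -> (x != 0) || (w != 0).
  by case=> /eqP ->; rewrite ?orbT.
rewrite vdmE !mulf_eq0 !subr_eq0 => /orP[/orP[] | ] /eqP E.
- have [||g [d0 d1 d2]] :=
    @flex_on_mirror (u 0 0) (u 2 0) (d 0 0) (d 1 0) (d 2 0) k.
  + by apply: nz_or; move: nz3; rewrite -E; tauto.
  + move=> r; rewrite -tangE -E /cubic_xyz; ring.
  by case: (nprop g); apply: col3P; rewrite mxE ?d0 ?d1 ?d2 ?E.
- have [||g [d0 d1 d2]] :=
    @flex_on_mirror (u 1 0) (u 0 0) (d 1 0) (d 2 0) (d 0 0) k.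
  + by apply: nz_or; move: nz3; rewrite -E; tauto.
  + move=> r; rewrite -tangE -E /cubic_xyz; ring.
  by case: (nprop g); apply: col3P; rewrite mxE ?d0 ?d1 ?d2 ?E.
have [||g [d0 d1 d2]] :=
    @flex_on_mirror (u 2 0) (u 1 0) (d 2 0) (d 0 0) (d 1 0) k.
+ by apply: nz_or; move: nz3; rewrite -E; tauto.
+ move=> r; rewrite -tangE -E /cubic_xyz; ring.
by case: (nprop g); apply: col3P; rewrite mxE ?d0 ?d1 ?d2 ?E.
Qed.

End Curve.

(** * Similitudes of the normal form *)

Section Similitudes.
Variable K : fieldType.
Hypotheses (two_neq0 : 2 != 0 :> K) (three_neq0 : 3 != 0 :> K).
Variable c : K.
Hypotheses (c_neq0 : c != 0) (c_neq1 : c != 1) (c_neq9 : c != 9).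
Implicit Types (w : K) (u v : 'cV[K]_3).

Lemma flex_pt_rel (b : 'I_3 -> K) :
  \sum_i b i *: flex_pt K i = 0 -> forall i, b i = b 0.
Proof.
move=> rel.
have {}rel k :
  b 0 * flex_pt K 0 k 0 + b 1 * flex_pt K 1 k 0 + b 2 * flex_pt K 2 k 0 = 0.
  rewrite -(sum3 (fun i => b i * flex_pt K i k 0)).
  move/matrixP/(_ k 0): rel; rewrite summxE [RHS]mxE => rel; rewrite -[RHS]rel.
  by apply: eq_bigr => i _; rewrite [RHS]mxE.
have b20 : b 2 = b 0.
  apply/eqP; rewrite -subr_eq0 -oppr_eq0 -[X in _ == X](rel 1) !flex_ptE.
  by apply/eqP; ring.
have b12 : b 1 = b 2.
  apply/eqP; rewrite -subr_eq0 -oppr_eq0 -[X in _ == X](rel 0) !flex_ptE.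
  by apply/eqP; ring.
by apply: ord3_ind; rewrite ?b12 ?b20.
Qed.

Lemma row_perm_flex_pt (s : 'S_3) i :
  exists e, row_perm s (flex_pt K i) = e *: flex_pt K (s^-1 i)%g.
Proof.
apply: multiple_flex_pt; first by rewrite csum_perm csum_flex_pt.
by rewrite mxE permKV !mxE; elim/ord3_ind: i; rewrite /= ?subrr.
Qed.

Lemma cubicZ a u : cubic c (a *: u) = a ^+ 3 * cubic c u.
Proof. by rewrite !cubicE !mxE; ring. Qed.

(** The three flexes sum to zero, so their eigenvalues agree, and everything
    else follows from the image b of (1, 1, 1): the terms of F at
    flex_pt i + r (1, 1, 1) of degree one in r force b to be a multiple of
    (1, 1, 1), the same one as on the flexes unless c = 3, and the terms of
    degree three leave only a cube root of unity as the quotient. *)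
Lemma cubic_diag (B : 'M[K]_3) (al : 'I_3 -> K) (mu : K) :
    B \in unitmx -> (forall i, B *m flex_pt K i = al i *: flex_pt K i) ->
    (forall u, cubic c (B *m u) = mu * cubic c u) ->
  exists a b, [/\ a != 0, mu = a ^+ 3, b ^+ 3 = a ^+ 3, (3 - c) * (b - a) = 0
    & B = a%:M + const_mx ((b - a) / 3)].
Proof.
move=> uB Bflex0 Bcub; pose a := al 0.
have subE (u v : 'cV[K]_3) j : (u - v) j 0 = u j 0 - v j 0 by rewrite !mxE.
have addE (u v : 'cV[K]_3) j : (u + v) j 0 = u j 0 + v j 0 by rewrite !mxE.
have scE (u : 'cV[K]_3) j : (a *: u) j 0 = a * u j 0 by rewrite !mxE.
have Bflex i : B *m flex_pt K i = a *: flex_pt K i.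
  rewrite Bflex0 (@flex_pt_rel al) //.
  under eq_bigr do rewrite -Bflex0.
  rewrite -mulmx_sumr [X in _ *m X](_ : _ = 0) ?mulmx0 //.
  by apply: col3P; rewrite summxE sum3 !mxE /=; ring.
have nz_a : a != 0.
  apply: contra_neq (flex_pt_neq0 K 0) => a0.
  by rewrite -[LHS](mulKmx uB) Bflex a0 scale0r mulmx0.
have mu_a : mu = a ^+ 3.
  apply/eqP; rewrite -subr_eq0; apply/eqP.
  apply: (mulf_eq0I (mulf_neq0 two_neq0 c_neq0)).
  have := Bcub (flex_pt K 1 - flex_pt K 2).
  rewrite mulmxBr !Bflex -scalerBr cubicZ => E.
  transitivity (mu * cubic c (flex_pt K 1 - flex_pt K 2)
    - a ^+ 3 * cubic c (flex_pt K 1 - flex_pt K 2)); last by rewrite E subrr.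
  rewrite !cubicE !subE !flex_ptE; ring.
pose p : 'cV[K]_3 := const_mx 1; pose b := B *m p.
have pE j : p j 0 = 1 by rewrite mxE.
have bE i : b 0 0 + b 1 0 + b 2 0 - c * b i 0 = a * (3 - c).
  have H1 := Bcub (flex_pt K i + p); have H2 := Bcub (flex_pt K i - p).
  have H3 := Bcub p; move: H1 H2 H3.
  rewrite mulmxDr mulmxBr Bflex -/b mu_a => H1 H2 H3.
  apply/eqP; rewrite -subr_eq0; apply/eqP.
  apply: (mulf_eq0I (mulf_neq0 two_neq0 (expf_neq0 2 nz_a))).
  (* the part of degree one in p of the identity at flex_pt K i + p *)
  transitivity (
      (a ^+ 3 * cubic c (flex_pt K i + p) - cubic c (a *: flex_pt K i + b))
    - (a ^+ 3 * cubic c (flex_pt K i - p) - cubic c (a *: flex_pt K i - b))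
    - 2 * (a ^+ 3 * cubic c p - cubic c b)); last by rewrite H1 H2 H3; ring.
  rewrite !cubicE !(subE, addE, scE, pE).
  by elim/ord3_ind: i {H1 H2}; rewrite !flex_ptE; ring.
have b_const i : b i 0 = b 0 0.
  apply: (mulfI c_neq0); apply: (addrI (- (b 0 0 + b 1 0 + b 2 0))).
  apply: oppr_inj; rewrite !opprD !opprK !bE //.
have bb : b 0 0 ^+ 3 = a ^+ 3.
  have nz_9 : 9 - c != 0 by rewrite subr_eq0 eq_sym.
  apply: (mulfI nz_9); have := Bcub p; rewrite -/b mu_a !cubicE !pE.
  rewrite (b_const 1) (b_const 2) => E.
  transitivity (a ^+ 3 *
    ((1 + 1 + 1) * (1 * 1 + 1 * 1 + 1 * 1) - c * (1 * 1 * 1))); last by ring.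
  rewrite -E; ring.
exists a, (b 0 0); split=> //.
  have /eqP := bE 0; rewrite (b_const 1) (b_const 2) -subr_eq0 => /eqP <-.
  by ring.
apply/matrixP => j k.
have sumB : B j 0 + B j 1 + B j 2 = b 0 0.
  by rewrite -(b_const j) /b mxE sum3 !mxE !mulr1.
have difB i : B j 0 * flex_pt K i 0 0 + B j 1 * flex_pt K i 1 0
    + B j 2 * flex_pt K i 2 0 = a * flex_pt K i j 0.
  by move/matrixP/(_ j 0): (Bflex i); rewrite mxE sum3 [RHS]mxE.
have dE : flex_pt K (k + 2) j 0 - flex_pt K (k + 1) j 0 = 3 * (j == k)%:R - 1.
  elim/ord3_ind: j {sumB difB}; elim/ord3_ind: k;
  by rewrite !mxE /=; ring.
have : 3 * B j k = b 0 0 + a * (flex_pt K (k + 2) j 0 - flex_pt K (k + 1) j 0).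
  rewrite mulrBr -!difB -sumB; elim/ord3_ind: k {dE}; rewrite !mxE /=; ring.
rewrite dE => B3; apply: (mulfI three_neq0); rewrite {}B3.
move: (b 0 0) => be; rewrite !mxE.
by case: eqP => _ /=; rewrite ?mulr1n ?mulr0n; field.
Qed.

Let addE (u v : 'cV[K]_3) i : (u + v) i 0 = u i 0 + v i 0.
Proof. by rewrite mxE. Qed.

Let sclE a u i : (a *: u) i 0 = a * u i 0.
Proof. by rewrite mxE. Qed.

Lemma nform_col u T :
  nform c (col_mx u T%:M) = T * cubic c u - csum u * vdm u.
Proof. by rewrite /nform col_mxKu col_mxKd mxE mulr1n. Qed.

(** The hypothesis says that the second derivative of F along q vanishes
    identically; by polarity the gradient of F vanishes at q. *)
Lemma cubic_double_point q :
  (forall u, cubic c (u + 2 *: q) - 2 * cubic c (u + q) + cubic c u = 0) ->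
  q = 0.
Proof.
move=> aff; have cq : cubic c q = 0.
  apply: (mulf_eq0I (mulf_neq0 two_neq0 three_neq0)).
  rewrite -[RHS](aff 0) !cubicE !(addE, sclE) !mxE; ring.
have grad i : (cubic c (delta_mx i 0 + 2 *: q) - 2 * cubic c (delta_mx i 0 + q)
    + cubic c (delta_mx i 0) - 6 * cubic c q) = 0.
  by rewrite aff cq mulr0 subr0.
have [] := @cubic_smooth K three_neq0 c c_neq0 c_neq1 c_neq9
  (q 0 0) (q 1 0) (q 2 0).
- apply: (mulf_eq0I two_neq0); rewrite -[RHS](grad 0) !cubicE !(addE, sclE).
  by rewrite !mxE /cubic_dx /=; ring.
- apply: (mulf_eq0I two_neq0); rewrite -[RHS](grad 1) !cubicE !(addE, sclE).
  by rewrite !mxE /cubic_dx /=; ring.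
- apply: (mulf_eq0I two_neq0); rewrite -[RHS](grad 2) !cubicE !(addE, sclE).
  by rewrite !mxE /cubic_dx /=; ring.
by move=> q0 q1 q2; apply: col3P; rewrite mxE.
Qed.

(** The last axis is the triple point, and the vanishing upper right block
    says that B fixes it; the two equations are the coefficients of T^1 and T^0
    in the equality of the normal forms. *)
Lemma nform_block (B : 'M[K]_(3 + 1)) (lam : K) :
    B \in unitmx ->
    (forall v : 'cV_(3 + 1), nform c (B *m v) = lam * nform c v) ->
  exists A r t, [/\ B = block_mx A 0 r t%:M, A \in unitmx, t != 0,
    forall u, t * cubic c (A *m u) = lam * cubic c u &
    forall u, (r *m u) 0 0 * cubic c (A *m u) - csum (A *m u) * vdm (A *m u)
      = - lam * (csum u * vdm u)].
Proof.
move=> uB Bn.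
pose A := ulsubmx B; pose q := ursubmx B; pose r := dlsubmx B.
pose t := drsubmx B 0 0.
have BE : B = block_mx A q r t%:M by rewrite -mx11_scalar submxK.
have Bcol u T : B *m col_mx u T%:M
    = col_mx (A *m u + T *: q) (((r *m u) 0 0 + t * T)%:M).
  rewrite BE mul_block_col mul_mx_scalar -scalar_mxM [r *m u]mx11_scalar.
  by rewrite -raddfD /= [in RHS]mxE eqxx mulr1n.
have Bn2 u T : nform c (B *m col_mx u T%:M)
    = lam * (T * cubic c u - csum u * vdm u) by rewrite Bn nform_col.
have q0 : q = 0.
  apply: cubic_double_point => u.
  (* N is affine along the last axis, hence along its image (q, t) *)
  have aff (u0 : 'cV[K]_3) (T0 : K) :
      ((T0 + 2 * t) * cubic c (u0 + 2 *: q)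
        - csum (u0 + 2 *: q) * vdm (u0 + 2 *: q))
      - 2 * ((T0 + t) * cubic c (u0 + q) - csum (u0 + q) * vdm (u0 + q))
      + (T0 * cubic c u0 - csum u0 * vdm u0) = 0.
    pose v : 'cV[K]_(3 + 1) := invmx B *m col_mx u0 T0%:M.
    have [x [X vE]] : exists (x : 'cV[K]_3) (X : K), v = col_mx x X%:M.
      by exists (usubmx v), (dsubmx v 0 0); rewrite -mx11_scalar vsubmxK.
    have := mulKVmx uB (col_mx u0 T0%:M); rewrite -/v vE Bcol.
    case/eq_col_mx => u0E /matrixP/(_ 0 0); rewrite !mxE !mulr1n => T0E.
    have shift k : (T0 + k * t) * cubic c (u0 + k *: q)
        - csum (u0 + k *: q) * vdm (u0 + k *: q)
        = lam * ((X + k) * cubic c x - csum x * vdm x).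
      rewrite -nform_col -Bn2 Bcol -u0E -T0E scalerDl addrA.
      by congr (nform c (col_mx _ _%:M)); rewrite !mxE; ring.
    have := shift 2; have := shift 1; have := shift 0.
    rewrite !mul0r !scale0r !addr0 !mul1r !scale1r => -> -> ->; ring.
  have := congr2 (fun k l => k - l) (aff u 1) (aff u 0).
  by rewrite [RHS]subrr => E; rewrite -[RHS]E; ring.
have A_unit : A \in unitmx /\ t != 0.
  move: uB; rewrite BE q0 !unitmxE det_lblock det_scalar expr1 unitrM.
  by rewrite [t \is a _]unitfE => /andP.
have {}Bn2 u T : (((r *m u) 0 0 + t * T) * cubic c (A *m u)
      - csum (A *m u) * vdm (A *m u)) = lam * (T * cubic c u - csum u * vdm u).
  by rewrite -Bn2 Bcol q0 scaler0 addr0 nform_col.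
exists A, r, t; split; rewrite -?q0 //; try by case: A_unit.
  move=> u; transitivity (lam * (1 * cubic c u - csum u * vdm u)
    - lam * (0 * cubic c u - csum u * vdm u)); last by ring.
  by rewrite -!Bn2; ring.
by move=> u; have := Bn2 u 0; rewrite mulr0 addr0 => ->; ring.
Qed.

Lemma flex_image (A : 'M[K]_3) (mu : K) u :
    A \in unitmx -> (forall u, cubic c (A *m u) = mu * cubic c u) ->
  flex c u -> flex c (A *m u).
Proof.
move=> uA Acub [nz_u [d [nprop [k tang]]]]; split.
  by apply: contra_neq nz_u => Au; rewrite -(mulKmx uA u) Au mulmx0.
exists (A *m d); split=> [g E|].
  by case: (nprop g); rewrite -(mulKmx uA d) E -scalemxAr mulKmx.
by exists (mu * k) => r; rewrite scalemxAr -mulmxDr Acub tang mulrA.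
Qed.

Lemma flex_pt_coord_eq0 i j : (flex_pt K i j 0 == 0) = (i == j).
Proof.
elim/ord3_ind: i; elim/ord3_ind: j; rewrite !mxE /= ?subrr ?sub0r ?subr0;
by rewrite ?oppr_eq0 ?oner_eq0 ?eqxx.
Qed.

Lemma perm_of_flex_pt (A : 'M[K]_3) : A \in unitmx ->
    (forall i, exists j a, A *m flex_pt K i = a *: flex_pt K j) ->
  exists s : 'S_3, forall i, exists a, A *m flex_pt K i = a *: flex_pt K (s i).
Proof.
move=> uA /fin_all_exists[f /fin_all_exists[al Af]].
have f_inj : injective f.
  move=> i j fij; apply/eqP; rewrite -flex_pt_coord_eq0.
  have nz_a : al j != 0.
    apply: contra_neq (flex_pt_neq0 K j) => aj.
    by rewrite -(mulKmx uA (flex_pt K j)) Af aj scale0r mulmx0.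
  suff /matrixP/(_ j 0) : al j *: flex_pt K i = al i *: flex_pt K j.
    rewrite [LHS]mxE [RHS]mxE => /eqP.
    have /eqP -> : flex_pt K j j 0 == 0 by rewrite flex_pt_coord_eq0.
    by rewrite mulr0 mulf_eq0 (negPf nz_a).
  rewrite -(mulKmx uA (flex_pt K i)) -(mulKmx uA (flex_pt K j)) !Af fij.
  by rewrite -!scalemxAr !scalerA mulrC.
by exists (perm f_inj) => i; exists (al i); rewrite permE.
Qed.

(** Once A is known, the remaining equation reads r F = (b - t) e1 V with r
    linear; at points where V vanishes but F does not it gives r = 0, and then
    b = t. *)
Lemma nform_diag (B : 'M[K]_(3 + 1)) (lam : K) (al : 'I_3 -> K) :
    B \in unitmx ->
    (forall v : 'cV_(3 + 1), nform c (B *m v) = lam * nform c v) ->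
    (forall i, ulsubmx B *m flex_pt K i = al i *: flex_pt K i) ->
  exists w k, [/\ k != 0, B = k *: sym_mx 1 w & admissible c w].
Proof.
move=> uB Bn.
have [A [r [t [-> uA nz_t Acub Aquart]]]] := nform_block uB Bn.
rewrite block_mxKul => Afpt.
have [|a [b [nz_a mu_a ba ab AE]]] := @cubic_diag A al (lam / t) uA Afpt.
  by move=> u; apply: (mulfI nz_t); rewrite Acub; field.
have lamE : lam = t * a ^+ 3 by rewrite -mu_a mulrC divfK.
have Au (u : 'cV[K]_3) i : (A *m u) i 0 = a * u i 0 + (b - a) / 3 * csum u.
  rewrite AE mulmxDl mul_scalar_mx mxE [_ i 0]mxE; congr (_ + _).
  by rewrite mxE csumE sum3 !mxE -!mulrDr.
have eA u : csum (A *m u) = b * csum u.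
  by rewrite {1}csumE !Au csumE; field.
have vA u : vdm (A *m u) = a ^+ 3 * vdm u by rewrite !vdmE !Au; ring.
have {Aquart} rel u : (r *m u) 0 0 * cubic c u = (b - t) * (csum u * vdm u).
  apply: (mulfI (expf_neq0 3 nz_a)).
  have cA : cubic c (A *m u) = a ^+ 3 * cubic c u.
    by apply: (mulfI nz_t); rewrite Acub lamE; ring.
  have := Aquart u; rewrite cA eA vA lamE => E.
  transitivity ((r *m u) 0 0 * (a ^+ 3 * cubic c u)
     - b * csum u * (a ^+ 3 * vdm u) + b * csum u * (a ^+ 3 * vdm u)).
    by ring.
  rewrite E; ring.
(* the points (-2, 1, 1), ... and (1, 1, 1), where V vanishes but F does not *)
pose p i : 'cV[K]_3 := const_mx 1 - 3 *: delta_mx i 0.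
have rp0 i : (r *m p i) 0 0 = 0.
  apply: (mulf_eq0I (mulf_neq0 two_neq0 c_neq0)).
  transitivity ((r *m p i) 0 0 * cubic c (p i)).
    rewrite mulrC; congr (_ * _); rewrite cubicE.
    by elim/ord3_ind: i; rewrite !mxE /=; ring.
  rewrite rel (_ : csum (p i) = 0) ?mul0r ?mulr0 //.
  by rewrite csumE; elim/ord3_ind: i; rewrite !mxE /=; ring.
pose one : 'cV[K]_3 := const_mx 1.
have r10 : (r *m one) 0 0 = 0.
  apply: (@mulf_eq0I _ (9 - c)); first by rewrite subr_eq0 eq_sym.
  transitivity ((r *m one) 0 0 * cubic c one).
    rewrite mulrC; congr (_ * _); rewrite cubicE !mxE; ring.
  by rewrite rel vdmE !mxE; ring.
have r0 : r = 0.
  apply/rowP => i; rewrite [RHS]mxE; apply: (mulf_eq0I three_neq0).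
  have E : (r *m p i) 0 0 = (r *m one) 0 0 - 3 * r 0 i.
    by rewrite mulmxBr -scalemxAr -colE !mxE.
  by apply: oppr_inj; rewrite oppr0 -[RHS](rp0 i) E r10 add0r.
have tb : t = b.
  apply/eqP; rewrite eq_sym -subr_eq0; apply/eqP.
  apply: (mulf_eq0I (mulf_neq0 two_neq0 three_neq0)).
  have := rel (\col_i ((i == 1)%:R + 2 * (i == 2)%:R)).
  rewrite r0 mul0mx mxE mul0r csumE vdmE !mxE /= => E.
  rewrite [RHS]E; ring.
exists (b / a), a; split=> //.
  rewrite /sym_mx perm_mx1 odd_perm1 expr0 mul1r r0 tb AE.
  rewrite scale_block_mx !scaler0.
  congr block_mx; last by rewrite scale_scalar_mx mulrC divfK.
  apply/matrixP => i j; rewrite !mxE.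
  by case: eqP => _ /=; rewrite ?mulr1n ?mulr0n; field;
    rewrite ?nz_a ?three_neq0.
move/eqP: ab; rewrite mulf_eq0 !subr_eq0 => /orP[] /eqP.
  by move=> <-; right; rewrite exprMn exprVn ba mulfV ?expf_neq0.
by move=> ->; left; rewrite mulfV.
Qed.

(** B permutes the flexes lying on the lines e1 V = 0, and composing B with a
    permutation of the coordinates reduces to the case where it fixes them. *)
Theorem nform_similitude (B : 'M[K]_(3 + 1)) (lam : K) :
    B \in unitmx ->
    (forall v : 'cV_(3 + 1), nform c (B *m v) = lam * nform c v) ->
  exists s w k, [/\ k != 0, B = k *: sym_mx s w & admissible c w].
Proof.
move=> uB Bn.
have [A [r [t [BE uA nz_t Acub Aquart]]]] := nform_block uB Bn.
have Acub' u : cubic c (A *m u) = lam / t * cubic c u.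
  by apply: (mulfI nz_t); rewrite Acub; field.
have [|s As] := perm_of_flex_pt uA.
  move=> i; have [||j [a E]] := @flex_on_lines K two_neq0 three_neq0 c
    c_neq0 c_neq1 c_neq9 (A *m flex_pt K i).
  - exact: flex_image uA Acub' (flex_ptP c i).
  - have := Aquart (flex_pt K i).
    have c0 : cubic c (flex_pt K i) = 0.
      by elim/ord3_ind: i; rewrite cubicE !flex_ptE; ring.
    rewrite Acub' c0 !mulr0 csum_flex_pt mul0r mulr0 sub0r => /eqP.
    by rewrite oppr_eq0 => /eqP.
  by exists j, a.
pose D := sym_mx s (1 : K).
have uD : D \in unitmx := sym_mx_unit three_neq0 s (oner_neq0 K).
have nform_BD (v : 'cV_(3 + 1)) :
    nform c (B *m D *m v) = lam * (-1) ^+ s * nform c v.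
  rewrite -mulmxA Bn -mulrA; congr (_ * _).
  have := @nform_sym K three_neq0 K idfun c s 1 v (or_introl erefl).
  by rewrite map_mx_id //= => ->; congr (_ * _); apply: mulr1.
(* composing with D undoes the permutation of the flexes *)
have BD_flex_pt i :
    exists a, ulsubmx (B *m D) *m flex_pt K i = a *: flex_pt K i.
  rewrite BE mulmx_block block_mxKul mulmx0 addr0.
  rewrite subrr mul0r [const_mx 0]/(0 : 'M_3) addr0 -mulmxA -row_permE.
  have [e ->] := row_perm_flex_pt s i; have [a Ea] := As (s^-1 i)%g.
  by exists (e * a); rewrite -scalemxAr Ea permKV scalerA.
have [al BDal] := fin_all_exists BD_flex_pt.
have uBD : B *m D \in unitmx by rewrite unitmx_mul uB.
have [w [k [nz_k BDE w3]]] := nform_diag uBD nform_BD BDal.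
exists s^-1%g, w, k; split=> //.
rewrite -[LHS](mulmxK uD) BDE -scalemxAl sym_mxV ?oner_neq0 // invr1.
by rewrite sym_mxM // mul1g mulr1.
Qed.

End Similitudes.

(** * The quartic in adapted coordinates *)

(** The polynomial Q(a) as a function of four elements of any commutative ring:
    at the variables it is Q(a) itself, at linear forms its transforms. *)
Definition quartic (R : comNzRingType) (a : R) (v : 'cV[R]_4) : R :=
  let x := v 0 0 in let y := v 1 0 in let z := v 2 0 in let t := v 3 0 in
  (2 * a) * (x ^+ 3 * y) + (4 * a) * (x ^+ 2 * y ^+ 2)
  + (2 * a) * (x * y ^+ 3)
  - ((2 * a - 1) * (a - 2)) * (x ^+ 3 * z)
  - (5 * a ^+ 2 - 17 * a + 5) * (x ^+ 2 * y * z)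
  - (3 * (a ^+ 2 - 4 * a + 1)) * (x * y ^+ 2 * z)
  + a * (y ^+ 3 * z)
  - (3 * (2 * a - 1) * (a - 2)) * (x ^+ 2 * z ^+ 2)
  - (7 * a ^+ 2 - 19 * a + 7) * (x * y * z ^+ 2)
  + (2 * a) * (y ^+ 2 * z ^+ 2)
  - (2 * (2 * a - 1) * (a - 2)) * (x * z ^+ 3)
  + a * (y * z ^+ 3)
  - (2 * a) * (t * x ^+ 2 * y) - (2 * a) * (t * x * y ^+ 2)
  + (2 * (2 * a - 1) * (a - 2)) * (t * x ^+ 2 * z)
  + (4 * (a ^+ 2 - 3 * a + 1)) * (t * x * y * z)
  - (2 * a) * (t * y ^+ 2 * z)
  + (2 * (2 * a - 1) * (a - 2)) * (t * x * z ^+ 2)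
  - (2 * a) * (t * y * z ^+ 2).

Lemma rmorph_quartic (R S : comNzRingType) (h : {rmorphism R -> S}) a v :
  h (quartic a v) = quartic (h a) (map_mx h v).
Proof.
rewrite /quartic !mxE.
by rewrite !(rmorphD, rmorphN, rmorphM, rmorphXn, rmorph1, rmorph_nat).
Qed.

Lemma sum4 (R : comNzRingType) (f : 'I_4 -> R) :
  \sum_i f i = f 0 + f 1 + f 2 + f 3.
Proof.
rewrite !big_ord_recl big_ord0 addr0 !addrA.
by congr (f _ + f _ + f _ + f _); apply: val_inj.
Qed.

Section Coordinates.
Variable K : fieldType.

(** The rows are the coordinates x, z, w = -(x + y + z) and
    T = 4t - 2x - 3y - 4z, in which the six symmetries coming from S_3 are
    signed permutations. *)
Definition coord_mx : 'M[K]_(3 + 1) := mx_of_rows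
  [:: [::  1;  0;  0; 0];
      [::  0;  0;  1; 0];
      [:: -1; -1; -1; 0];
      [:: -2; -3; -4; 4]].

Lemma coord_mx_unit : 2 != 0 :> K -> coord_mx \in unitmx.
Proof.
move=> nz2; apply: (@mul_scalar_unitmx _ _ 4 (mx_of_rows
  [:: [::  4;  0;  0; 0];
      [:: -4; -4; -4; 0];
      [::  0;  4;  0; 0];
      [:: -1;  1; -3; 1]])).
  by rewrite (_ : 4 = 2 * 2) ?mulf_neq0 //; ring.
apply/matrixP=> i j; rewrite !mxE sum4 !mxE.
by case: i => [[|[|[|[|//]]]] ?]; case: j => [[|[|[|[|//]]]] ?]; rewrite /=;
  ring.
Qed.

Lemma quartic_nform (R : comNzRingType) (f : {rmorphism K -> R}) (a c : K)
    (v : 'cV[R]_4) : a * c = - ((2 * a - 1) * (a - 2)) ->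
  2 * quartic (f a) v = - f a * nform (f c) (map_mx f coord_mx *m v).
Proof.
move=> ac.
have plane (i : 'I_3) : usubmx (map_mx f coord_mx *m v) i 0 =
    nth 0 [:: v 0 0; v 2 0; - (v 0 0 + v 1 0 + v 2 0)] i.
  rewrite mxE mxE sum4 !mxE.
  elim/ord3_ind: i; rewrite /= ?(rmorph0, rmorph1, rmorphN1); ring.
have height : dsubmx (map_mx f coord_mx *m v) 0 0 =
    4 * v 3 0 - 2 * v 0 0 - 3 * v 1 0 - 4 * v 2 0.
  rewrite mxE mxE sum4 !mxE /= ?(rmorph0, rmorphN, rmorph_nat); ring.
rewrite /nform csumE vdmE cubicE height !plane /=.
have {}ac : f a * f c = - ((2 * f a - 1) * (f a - 2)).
  by rewrite -rmorphM ac rmorphN rmorphM !rmorphB rmorphM !rmorph_nat rmorph1.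
move: (f a) (f c) ac => {}a {}c ac; rewrite /quartic.
move: (v 0 0) (v 1 0) (v 2 0) (v 3 0) => x y z t /=.
set w := (- (x + y + z)).
transitivity (- (4 * t - 2 * x - 3 * y - 4 * z) * (a * ((x + z + w) *
   (x * z + x * w + z * w)) - (a * c) * (x * z * w))
   + a * ((x + z + w) * ((x - z) * (z - w) * (w - x)))).
  rewrite ac /w; ring.
ring.
Qed.

Lemma Q_quartic (a : K) : Q a = quartic a%:MP (\col_i 'X_i).
Proof.
have [o0 o1 o2 o3] : [/\ @Ordinal 4 0 isT = 0, @Ordinal 4 1 isT = 1,
    @Ordinal 4 2 isT = 2 & @Ordinal 4 3 isT = 3] by split; apply: val_inj.
rewrite /quartic !mxE /Q -!mul_mpolyC o0 o1 o2 o3.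
move: 'X_0 'X_1 'X_2 'X_3 => x y z t.
ring.
Qed.

End Coordinates.

(** * The stabiliser *)

Section Stabiliser.
Variable K : fieldType.
Hypotheses (two_neq0 : 2 != 0 :> K) (three_neq0 : 3 != 0 :> K).
Variables a c : K.
Hypotheses (a_neq0 : a != 0) (ac : a * c = - ((2 * a - 1) * (a - 2))).
Hypotheses (c_neq0 : c != 0) (c_neq1 : c != 1) (c_neq9 : c != 9).
Implicit Types (s : 'S_3) (w : K).

Let P : 'M[K]_4 := coord_mx K.
Let uP : P \in unitmx := coord_mx_unit two_neq0.

Definition stab_mx s w : 'M[K]_4 := invmx P *m sym_mx s w *m P.
Definition stab_elt s w : PGL K 4 := pgl_class (stab_mx s w).

Lemma stab_mx_unit s w : w != 0 -> stab_mx s w \in unitmx.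
Proof. by move=> nz_w; rewrite !unitmx_mul unitmx_inv uP sym_mx_unit. Qed.

Lemma stab_mxM s w s' w' :
  stab_mx s w *m stab_mx s' w' = stab_mx (s * s')%g (w * w').
Proof. by rewrite /stab_mx -sym_mxM // !mulmxA mulmxK. Qed.

Lemma stab_mxV s w : w != 0 -> invmx (stab_mx s w) = stab_mx s^-1 w^-1.
Proof.
move=> nz_w; rewrite -[RHS]mul1mx -(mulVmx (stab_mx_unit s nz_w)).
rewrite -mulmxA stab_mxM.
by rewrite mulgV mulfV // /stab_mx sym_mx1 // mulmx1 mulVmx // mulmx1.
Qed.

Lemma stab_eltM s w s' w' : w != 0 -> w' != 0 ->
  (stab_elt s w * stab_elt s' w')%g = stab_elt (s * s')%g (w * w').
Proof. by move=> nz_w nz_w'; rewrite pgl_classM ?stab_mx_unit // stab_mxM. Qed.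

Lemma pgl_class_val n (A : 'M[K]_n) : A \in unitmx ->
  Defs.GLval (insubd (1%g : GL K n) A) = A.
Proof. by move=> uA; apply: (insubdK _ uA). Qed.

Lemma pgl_class_eq n (A B : 'M[K]_n) : A \in unitmx -> B \in unitmx ->
  pgl_class A = pgl_class B <-> exists2 k, k != 0 & A = k *: B.
Proof.
move=> uA uB; split.
  by move/pi_PGLE => [k nz_k]; rewrite !pgl_class_val //; exists k.
by case=> k nz_k AB; apply/pi_PGLE; exists k; rewrite ?pgl_class_val.
Qed.

Lemma stab_elt_inj s w s' w' : w != 0 -> w' != 0 ->
  stab_elt s w = stab_elt s' w' -> s = s' /\ w = w'.
Proof.
move=> nz_w nz_w' /pgl_class_eq[] ; rewrite ?stab_mx_unit // => k nz_k E.
apply: (sym_mx_inj three_neq0 nz_k nz_w').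
move: E; rewrite /stab_mx scalemxAl scalemxAr => /(can_inj (mulmxK uP)).
by move/(can_inj (mulKVmx uP)).
Qed.

Lemma mx_act_Q (A : 'M[K]_4) :
  mx_act A (Q a) =
    quartic a%:MP (map_mx (@mpolyC 4 K) (invmx A) *m \col_i 'X_i).
Proof.
rewrite /mx_act Q_quartic; set T := [tuple _ | _ < _].
rewrite (rmorph_quartic (comp_mpoly T)) /= comp_mpolyC; congr quartic.
apply/colP => i; rewrite !mxE comp_mpolyXU -tnth_nth tnth_mktuple.
by apply: eq_bigr => j _; rewrite !mxE mul_mpolyC.
Qed.

Lemma quartic_stab_mx (R : comNzRingType) (f : {rmorphism K -> R}) s w
    (v : 'cV[R]_4) :
    admissible c w ->
  quartic (f a) (map_mx f (stab_mx s w) *m v) =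
    f ((-1) ^+ s * w) * quartic (f a) v.
Proof.
move=> w3; have inj2 : injective (fun x : R => 2 * x).
  apply: (can_inj (g := fun x => f 2^-1 * x)) => x.
  by rewrite mulrA -(rmorph_nat f 2) -rmorphM mulVf // rmorph1 mul1r.
apply: inj2; rewrite mulrCA !(quartic_nform f v ac, quartic_nform f _ ac).
rewrite mulmxA -map_mxM {1}/stab_mx !mulmxA mulmxV // mul1mx map_mxM -mulmxA.
by rewrite nform_sym // mulrCA.
Qed.

Lemma stab_elt_stabiliser s w :
  admissible c w -> stabiliser (Q a) (stab_elt s w).
Proof.
move=> w3; have nz_w := admissible_neq0 w3.
exists (insubd (1%g : GL K 4) (stab_mx s w)) => //.
rewrite pgl_class_val ?stab_mx_unit // mx_act_Q stab_mxV //.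
have w3V := admissibleV w3.
exists ((-1) ^+ (s^-1)%g * w^-1).
  by rewrite mulf_neq0 ?signr_eq0 ?invr_eq0.
by rewrite quartic_stab_mx // mul_mpolyC Q_quartic.
Qed.

(** The polynomial identity is only needed at the points with coordinates in K,
    because the similitudes of the normal form are found by evaluation. *)
Lemma stabiliser_stab_elt g : stabiliser (Q a) g ->
  exists s w, admissible c w /\ g = stab_elt s w.
Proof.
case=> A <- [lam _ actA]; pose M := Defs.GLval A.
have uM : M \in unitmx by case: A @M {actA}.
pose B : 'M[K]_(3 + 1) := P *m invmx M *m invmx P.
have uB : B \in unitmx by rewrite !unitmx_mul !unitmx_inv uP uM.
have quarticM (v : 'cV[K]_4) : quartic a (invmx M *m v) = lam * quartic a v.
  pose ev : {rmorphism {mpoly K[4]} -> K} := meval (fun i => v i 0).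
  have evX : map_mx ev (\col_i 'X_i) = v.
    by apply/colP => i; rewrite !mxE; exact: mevalXU.
  have evC x : ev x%:MP = x by exact: mevalC.
  have evM : map_mx ev (map_mx (@mpolyC 4 K) (invmx M)) = invmx M.
    by apply/matrixP => i j; rewrite !mxE evC.
  have evQ x u : ev (quartic x%:MP u) = quartic x (map_mx ev u).
    by rewrite rmorph_quartic evC.
  have := actA; rewrite mx_act_Q Q_quartic -mul_mpolyC => {}actA.
  have := evQ a (map_mx (@mpolyC 4 K) (invmx M) *m \col_i 'X_i).
  rewrite map_mxM evM evX => <-; rewrite actA.
  have := evQ a (\col_i 'X_i); rewrite evX => <-.
  by rewrite [LHS]rmorphM; congr (_ * _).
have nformB (v : 'cV[K]_(3 + 1)) : nform c (B *m v) = lam * nform c v.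
  have toN (u : 'cV[K]_4) : 2 * quartic a u = - a * nform c (P *m u).
    have := quartic_nform idfun u ac.
    by rewrite map_mx_id.
  have na : - a != 0 by rewrite oppr_eq0.
  apply: (mulfI na); rewrite mulrCA -[v in RHS](mulKVmx uP) -[B *m v]mulmxA.
  by rewrite -mulmxA -!toN quarticM mulrCA.
have [s [w [k [nz_k BE w3]]]] :=
  nform_similitude two_neq0 three_neq0 c_neq0 c_neq1 c_neq9 uB nformB.
have nz_w := admissible_neq0 w3.
exists s^-1%g, w^-1; split; first exact: admissibleV.
have ME : M = k^-1 *: stab_mx s^-1 w^-1.
  have : invmx M = k *: stab_mx s w.
    rewrite /stab_mx scalemxAl scalemxAr -BE /B !mulmxA mulVmx // mul1mx.
    by rewrite mulmxKV.
  move/(congr1 invmx); rewrite invmxK invmxZ ?unitmxZ ?unitfE ?stab_mx_unit //.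
  by rewrite stab_mxV.
apply/pi_PGLE; exists k^-1; rewrite ?invr_eq0 //.
by rewrite pgl_class_val ?stab_mx_unit ?invr_eq0.
Qed.

Lemma sym_mx_row_plane s w (A : 'M[K]_(3 + 1)) i j :
  (sym_mx s w *m A) (lshift 1 i) j =
    A (lshift 1 (s i)) j + (w - 1) / 3 * \sum_k A (lshift 1 k) j.
Proof.
rewrite -[A in LHS]vsubmxK mul_block_col col_mxEu mul0mx addr0 mulmxDl.
rewrite -row_permE !mxE; congr (_ + _).
by rewrite mulr_sumr; apply: eq_bigr => k _; rewrite !mxE.
Qed.

Lemma sym_mx_row_height s w (A : 'M[K]_(3 + 1)) i j :
  (sym_mx s w *m A) (rshift 3 i) j = (-1) ^+ s * w * A (rshift 3 i) j.
Proof.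
rewrite -[A in LHS]vsubmxK mul_block_col col_mxEd mul0mx add0r.
by rewrite mul_scalar_mx !mxE.
Qed.

(** A test by entries for M to be proportional to [stab_mx s w]; the scalars b
    and d are separate arguments so that the caller can give them in a form
    that makes the entries linear in the parameters. *)
Lemma pgl_class_stab_elt (M : 'M[K]_(3 + 1)) s w k b d :
    M \in unitmx -> w != 0 -> k != 0 ->
    3 * b = k * (w - 1) -> d = k * ((-1) ^+ s * w) ->
    (forall (i : 'I_3) j, (P *m M) (lshift 1 i) j =
      k * P (lshift 1 (s i)) j + b * (P 0 j + P 1 j + P 2 j)) ->
    (forall j, (P *m M) (rshift 3 0) j = d * P 3 j) ->
  pgl_class M = stab_elt s w.
Proof.
move=> uM nz_w nz_k bE dE plane height.
apply/pgl_class_eq; rewrite ?stab_mx_unit //; exists k => //.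
rewrite -[LHS](mulKmx uP) /stab_mx -mulmxA scalemxAr; congr (_ *m _).
have {}bE : b = k * ((w - 1) / 3).
  by apply: (mulfI three_neq0); rewrite bE; field.
apply/matrixP => i j; rewrite [RHS]mxE.
case: (@split_ordP 3 1 i) => i' ->;
  rewrite ?sym_mx_row_plane ?sym_mx_row_height.
  rewrite plane bE sum3 -[X in _ + X]mulrA -mulrDr; congr (_ * (_ + _ * _)).
  by congr (P _ _ + P _ _ + P _ _); apply: val_inj.
rewrite ord1 height dE -mulrA; congr (_ * (_ * _)).
by congr (P _ _); apply: val_inj.
Qed.

Lemma pgl_class_M1 : M1 K \in unitmx ->
  pgl_class (M1 K) = stab_elt (tperm 0 2 * tperm 0 1%R)%g 1.
Proof.
move=> uM; apply: (@pgl_class_stab_elt _ _ _ (-2) 0 (-2));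
  rewrite ?oner_eq0 ?oppr_eq0 //.
- ring.
- by rewrite odd_permM !odd_tperm /= expr0; ring.
- move=> i j; rewrite mxE sum4 !mxE permM !permE /=.
  by elim/ord3_ind: i; case: j => [[|[|[|[|//]]]] ?]; rewrite /=; ring.
move=> j; rewrite mxE sum4 !mxE.
by case: j => [[|[|[|[|//]]]] ?]; rewrite /=; ring.
Qed.

Lemma pgl_class_M2 : M2 K \in unitmx ->
  pgl_class (M2 K) = stab_elt (tperm 0 2) 1.
Proof.
move=> uM; apply: (@pgl_class_stab_elt _ _ _ (-2) 0 2);
  rewrite ?oner_eq0 ?oppr_eq0 //.
- ring.
- by rewrite odd_tperm /= expr1; ring.
- move=> i j; rewrite mxE sum4 !mxE !permE /=.
  by elim/ord3_ind: i; case: j => [[|[|[|[|//]]]] ?]; rewrite /=; ring.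
move=> j; rewrite mxE sum4 !mxE.
by case: j => [[|[|[|[|//]]]] ?]; rewrite /=; ring.
Qed.

(** Up to exchanging x and z, the third matrix multiplies the differences of the
    coordinates by 2a - 4, and e1 = -y by 2 - 4a = (2a - 4) a^2. *)
Lemma pgl_class_M3 : M3 a \in unitmx -> a ^+ 2 - a + 1 = 0 ->
  pgl_class (M3 a) = stab_elt (tperm 0 1) ((- a) ^+ 2).
Proof.
move=> uM a_root.
have a2 : a ^+ 2 = a - 1.
  by apply/eqP; rewrite -subr_eq0 -[X in _ == X]a_root; apply/eqP; ring.
have nz_a : a != 0.
  by apply: contra_eq_neq a_root => ->; rewrite expr0n subr0 add0r oner_neq0.
apply: (@pgl_class_stab_elt _ _ _ (2 * a - 4) (2 - 2 * a) (4 * a - 2)) => //.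
- by rewrite sqrrN expf_neq0.
- apply: contra_neq (mulf_neq0 two_neq0 three_neq0) => a2E.
  transitivity (2 * (a ^+ 2 - a + 1) - (a + 1) * (2 * a - 4)); first by ring.
  by rewrite a_root a2E; ring.
- rewrite sqrrN.
  transitivity ((2 * a - 4) * (a ^+ 2 - 1) - 2 * (a - 1) * (a ^+ 2 - a + 1)).
    ring.
  by rewrite a_root mulr0 subr0.
- rewrite odd_tperm /= expr1 sqrrN a2.
  transitivity (- 2 * a ^+ 2 + 6 * a - 4); last by ring.
  by rewrite a2; ring.
- move=> i j; rewrite mxE sum4 !mxE !permE /=.
  by elim/ord3_ind: i; case: j => [[|[|[|[|//]]]] ?]; rewrite /=; ring.
move=> j; rewrite mxE sum4 !mxE.
by case: j => [[|[|[|[|//]]]] ?]; rewrite /=; ring.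
Qed.

End Stabiliser.

(** * Generators of abstract groups *)

Section Subgroups.
Import GroupScope.

Lemma is_subgroupP (G : groupType) (H : G -> Prop) : is_subgroup H ->
  [/\ H 1, forall x, H x -> H x^-1 & forall x y, H x -> H y -> H (x * y)].
Proof.
move=> [H1 Hdiv]; have Hinv x : H x -> H x^-1.
  by move=> Hx; rewrite -[x^-1]mul1g; apply: Hdiv.
by split=> // x y Hx Hy; rewrite -[y]invgK; apply/Hdiv/Hinv.
Qed.

(** Generators of the source of an isomorphism onto H map to generators of H:
    the preimage of a subgroup is a subgroup. *)
Lemma is_generated_by_image (gT G : groupType) (f : gT -> G) (H : G -> Prop)
    (us : seq gT) :
    {morph f : u v / u * v} -> (forall x, H x <-> exists u, f u = x) ->
    (forall u, Defs.generated us u) ->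
  is_generated_by H (map f us).
Proof.
move=> fM Him gen_us.
have f1 : f 1 = 1 by apply: (mulgI (f 1)); rewrite -fM !mulg1.
have fV u : f u^-1 = (f u)^-1.
  by apply: (mulgI (f u)); rewrite -fM !mulgV.
move=> x; split=> [/Him[u <-] H' subH' genH' | gen_x].
  apply: (gen_us u (fun v => H' (f v))) => [|v us_v].
    have [H'1 H'V H'M] := is_subgroupP subH'.
    split=> [|v w Hv Hw]; first by rewrite f1.
    by rewrite fM fV; apply/H'M/H'V.
  by apply: genH'; apply: map_f.
apply: gen_x => [|y /mapP[u _ ->]]; last by apply/Him; exists u.
split=> [|y z /Him[u <-] /Him[v <-]]; apply/Him; first by exists 1.
by exists (u * v^-1); rewrite fM fV.
Qed.

Lemma generated_S3 (u : 'S_3) :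
  Defs.generated [:: tperm 0%R 1%R; tperm 0%R 2%R] u.
Proof.
move=> H /is_subgroupP[H1 _ HM] genH.
have H01 : H (tperm 0%R 1%R) by apply: genH; rewrite inE eqxx.
have H02 : H (tperm 0%R 2%R) by apply: genH; rewrite !inE eqxx orbT.
have H12 : H (tperm 1%R 2%R).
  have <- : tperm 0%R 2%R ^ tperm 0%R 1%R = tperm 1%R 2%R :> 'S_3.
    by rewrite tpermJ tpermL tpermD.
  by rewrite conjgE tpermV; apply: (HM) => //; apply: (HM).
have Ht : forall i j : 'I_3, H (tperm i j).
  by apply: ord3_ind; apply: ord3_ind; rewrite ?tperm1 // tpermC.
have [ts -> _] := prod_tpermP u.
by apply: big_ind => // t _; apply: Ht.
Qed.

End Subgroups.

Lemma generated_S3_3cycle (u : 'S_3) :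
  Defs.generated [:: (tperm 0 2 * tperm 0 1%R)%g; tperm 0 2] u.
Proof.
move=> H subH genH; have [_ HV HM] := is_subgroupP subH.
have H02 : H (tperm 0 2) by apply: genH; rewrite !inE eqxx orbT.
have H021 : H (tperm 0 2 * tperm 0 1%R)%g by apply: genH; rewrite inE eqxx.
apply: generated_S3 subH _ => s; rewrite !inE => /orP[] /eqP -> //.
by rewrite -[tperm 0 1](mulKg (tperm 0 2)); apply: (HM) => //; apply: HV.
Qed.

(** The second generator has order six: its square is 1 in C_3, and multiplying
    by that removes its C_3 component. *)
Lemma generated_S3_C3 (u : ('S_3 * 'Z_3)%type) :
  @Defs.generated ('S_3 * 'Z_3)%type [:: (tperm 0 2, 0); (tperm 0 1, 2)] u.
Proof.
move=> H subH genH; have [_ HV HM] := is_subgroupP subH.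
have HpM (s t : 'S_3) (i j : 'Z_3) :
    H (s, i) -> H (t, j) -> H ((s * t)%g, i + j).
  exact: HM.
have HpV (s : 'S_3) (i : 'Z_3) : H (s, i) -> H (s^-1%g, - i) by apply: HV.
have H02 : H (tperm 0 2, 0) by apply: genH; rewrite inE eqxx.
have H012 : H (tperm 0 1, 2) by apply: genH; rewrite !inE eqxx orbT.
have H1_1 : H (1%g, 1).
  suff -> : (1%g, 1) = ((tperm 0 1%R * tperm 0 1%R)%g, 2 + 2) :> 'S_3 * 'Z_3.
    exact: HpM.
  by rewrite tperm2; congr (_, _); apply: val_inj.
have HC i : H (1%g, i).
  have H1_2 : H (1%g, 2).
    suff -> : (1%g, 2) = ((1 * 1)%g, 1 + 1) :> 'S_3 * 'Z_3 by exact: HpM.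
    by rewrite mulg1; congr (_, _); apply: val_inj.
  have H1_0 : H (1%g, 0).
    suff -> : (1%g, 0) = ((1 * 1)%g, 1 + 2) :> 'S_3 * 'Z_3 by exact: HpM.
    by rewrite mulg1; congr (_, _); apply: val_inj.
  by elim/ord3_ind: i.
have H01 : H (tperm 0 1, 0).
  suff -> : (tperm 0 1, 0) = ((tperm 0 1%R * 1)%g, 2 + 1) :> 'S_3 * 'Z_3.
    exact: HpM.
  by rewrite mulg1; congr (_, _); apply: val_inj.
have HS s : H (s, 0).
  apply: (@generated_S3 s (fun s => H (s, 0))) => [|t].
    split=> [|s1 s2 Hs1 Hs2]; first exact: HC.
    by rewrite -[0]subr0; apply: HpM => //; apply: HpV.
  by rewrite !inE => /orP[] /eqP ->.
by case: u => s i; rewrite -(mulg1 s) -(add0r i); apply: HpM.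
Qed.

(** * The stabiliser of the quartic *)

Lemma Q_Q' (K : fieldType) (a : K) : 2 != 0 :> K -> a ^+ 2 - a + 1 = 0 ->
  Q a = (2 * a) *: Q' K.
Proof.
move=> nz2 a_root.
(* modulo a^2 - a + 1 every coefficient is a multiple of a *)
have c1 : (2 * a - 1) * (a - 2) = - 3 * a.
  transitivity (2 * (a ^+ 2 - a + 1) - 3 * a); last rewrite a_root; ring.
have c2 : 5 * a ^+ 2 - 17 * a + 5 = - 12 * a.
  transitivity (5 * (a ^+ 2 - a + 1) - 12 * a); last rewrite a_root; ring.
have c3 : a ^+ 2 - 4 * a + 1 = - 3 * a.
  transitivity ((a ^+ 2 - a + 1) - 3 * a); last rewrite a_root; ring.
have c4 : 7 * a ^+ 2 - 19 * a + 7 = - 12 * a.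
  transitivity (7 * (a ^+ 2 - a + 1) - 12 * a); last rewrite a_root; ring.
have c5 : a ^+ 2 - 3 * a + 1 = - 2 * a.
  transitivity ((a ^+ 2 - a + 1) - 2 * a); last rewrite a_root; ring.
rewrite /Q /Q' -!(mulrA _ (2 * a - 1)) c1 c2 c3 c4 c5 -!mul_mpolyC.
pose h := (2^-1 : K)%:MP_[4].
have h2 : 2 * h = 1.
  by rewrite /h -(rmorph_nat (@mpolyC 4 K)) -mpolyCM mulfV.
have divE (k : nat) : (k%:R / 2 : K)%:MP_[4] = k%:R * h.
  by rewrite mpolyCM mpolyC_nat.
rewrite mul1r -/h !divE.
set x := 'X_(@Ordinal 4 0 isT); set y := 'X_(@Ordinal 4 1 isT).
set z := 'X_(@Ordinal 4 2 isT); set t := 'X_(@Ordinal 4 3 isT).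
pose A : {mpoly K[4]} := a%:MP.
(* the terms with a half-integral coefficient in Q' *)
pose odd := 3 * (x ^+ 3 * z) + 9 * (x * y ^+ 2 * z) + y ^+ 3 * z
  + 9 * (x ^+ 2 * z ^+ 2) + y * z ^+ 3.
transitivity (2 * A * (x ^+ 3 * y + 2 * (x ^+ 2 * y ^+ 2) + x * y ^+ 3
    + 6 * (x ^+ 2 * y * z) + 6 * (x * y * z ^+ 2) + y ^+ 2 * z ^+ 2
    + 3 * (x * z ^+ 3) - x ^+ 2 * y * t - x * y ^+ 2 * t
    - 3 * (x ^+ 2 * z * t) - 4 * (x * y * z * t) - y ^+ 2 * z * t
    - 3 * (x * z ^+ 2 * t) - y * z ^+ 2 * t) + A * odd * 1); rewrite /odd /A.
  move: x y z t {odd A} => x y z t; ring.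
rewrite -[X in _ + _ * X]h2; move: h x y z t {odd A h2 divE} => h x y z t; ring.
Qed.

Lemma cube_root_prim (K : fieldType) (z : K) :
  z ^+ 3 = 1 -> z != 1 -> 3.-primitive_root z.
Proof.
move=> z3 z_neq1; have [m prim_z] := @prim_order_exists K 3 z isT z3.
rewrite dvdn_divisors // !inE => /orP[] /eqP m_E; rewrite m_E in prim_z => //.
by have /eqP := prim_expr_order prim_z; rewrite expr1 (negPf z_neq1).
Qed.

(* C_3 is the additive group of 'Z_3, which is its group law as a groupType. *)
Theorem theorem9 (K : fieldType) (charK : [pchar K] =i pred0) (a : K)
    (a_gen : a \notin [:: -1; 0; 1 / 2; 1; 2]) :
  (a ^+ 2 - a + 1 <> 0 ->
     isomorphic_to (stabiliser (Q a)) 'S_3 /\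
     is_generated_by (stabiliser (Q a)) [:: pgl_class (M1 K); pgl_class (M2 K)])
  /\
  (a ^+ 2 - a + 1 = 0 ->
     [/\ same_surface (Q a) (Q' K),
         has_order (stabiliser (Q a)) 18,
         isomorphic_to (stabiliser (Q a)) ('S_3 * 'Z_3)%type
       & is_generated_by (stabiliser (Q a))
           [:: pgl_class (M2 K); pgl_class (M3 a)]]).
Proof.
have two_neq0 : 2 != 0 :> K by apply: (pchar0_neq0 1 charK).
have three_neq0 : 3 != 0 :> K by apply: (pchar0_neq0 2 charK).
move: a_gen; rewrite !inE !negb_or.
case/and5P => a_neqN1 a_neq0 a_neqV2 a_neq1 a_neq2.
pose c := - ((2 * a - 1) * (a - 2)) / a.
have ac : a * c = - ((2 * a - 1) * (a - 2)) by rewrite /c; field.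
(* -2 (a - 1)^2, -2 (a + 1)^2, -2 (a^2 - a + 1) for k = 1, 9, 3 *)
have c_shift k : a * (c - k) = - ((2 * a - 1) * (a - 2) + k * a).
  by rewrite mulrBr ac; ring.
have c_neq0 : c != 0.
  rewrite /c !mulf_neq0 ?invr_eq0 ?oppr_eq0 ?mulf_neq0 ?subr_eq0 //.
  by apply: contra_neq a_neqV2 => E; apply: (mulfI two_neq0); rewrite E; field.
have c_neq1 : c != 1.
  have nz_d : a - 1 != 0 by rewrite subr_eq0.
  rewrite -subr_eq0; apply: contra_neq (mulf_neq0 two_neq0 (expf_neq0 2 nz_d)).
  move=> E; have := c_shift 1; rewrite E mulr0 => F; apply: oppr_inj.
  rewrite oppr0 F; ring.
have c_neq9 : c != 9.
  have nz_d : a + 1 != 0 by rewrite addr_eq0.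
  rewrite -subr_eq0; apply: contra_neq (mulf_neq0 two_neq0 (expf_neq0 2 nz_d)).
  move=> E; have := c_shift 9; rewrite E mulr0 => F; apply: oppr_inj.
  rewrite oppr0 F; ring.
have c3E : (c == 3) = (a ^+ 2 - a + 1 == 0).
  rewrite -subr_eq0 -(inj_eq (mulfI a_neq0)) c_shift mulr0 oppr_eq0.
  rewrite -[RHS](inj_eq (mulfI two_neq0)) mulr0; congr (_ == 0); ring.
have eltM := stab_eltM two_neq0 three_neq0.
have elt_inj := stab_elt_inj two_neq0 three_neq0.
have elt_stab := stab_elt_stabiliser two_neq0 three_neq0 ac.
have stab_onto := stabiliser_stab_elt two_neq0 three_neq0 a_neq0 ac
  c_neq0 c_neq1 c_neq9.
have nz1 := oner_neq0 K.
have M1E := pgl_class_M1 two_neq0 three_neq0 (M1_unit charK).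
have M2E := pgl_class_M2 two_neq0 three_neq0 (M2_unit charK).
split=> a_root.
  have c_neq3 : c <> 3 by move/eqP; rewrite c3E => /eqP.
  pose f (s : 'S_3) : PGL K 4 := stab_elt s 1.
  have fM : {morph f : u v / (u * v)%g} by move=> u v; rewrite /f eltM // mulr1.
  have f_im g : stabiliser (Q a) g <-> exists u, f u = g.
    split=> [/stab_onto[s [w [w3 ->]]] | [s <-]]; last by apply: elt_stab; left.
    by case: w3 => [-> | [/c_neq3 []]]; exists s.
  split; first by exists f; split=> // u v /elt_inj[].
  have -> : [:: pgl_class (M1 K); pgl_class (M2 K)] =
      map f [:: (tperm 0 2 * tperm 0 1%R)%g; tperm 0 2] by rewrite /= M1E M2E.
  exact: is_generated_by_image fM f_im generated_S3_3cycle.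
have c3 : c = 3 by apply/eqP; rewrite c3E a_root.
pose z := - a.
have prim_z : 3.-primitive_root z.
  apply: cube_root_prim; last by rewrite /z eqr_oppLR.
  transitivity (1 - (a + 1) * (a ^+ 2 - a + 1)); first by rewrite /z; ring.
  by rewrite a_root; ring.
have nz_z i : z ^+ i != 0 by rewrite expf_neq0 // oppr_eq0.
pose f (u : ('S_3 * 'Z_3)%type) : PGL K 4 := stab_elt u.1 (z ^+ u.2).
have fM : {morph f : u v / (u * v)%g}.
  move=> u v; rewrite /f eltM // -exprD -(prim_expr_mod prim_z (_ + _)).
  by [].
have f_inj : injective f.
  move=> [s i] [t j] /elt_inj[]; rewrite ?nz_z //= => -> /eqP.
  rewrite (eq_prim_root_expr prim_z) !modn_small //= => /eqP ij.
  by congr (_, _); apply: val_inj.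
have f_im g : stabiliser (Q a) g <-> exists u, f u = g.
  split=> [/stab_onto[s [w [w3 ->]]] | [[s i] <-]].
    have : w ^+ 3 = 1 by case: w3 => [-> | []]; rewrite ?expr1n.
    by case/(prim_rootP prim_z) => i ->; exists (s, i).
  apply: elt_stab; right; split=> //.
  by rewrite exprAC (prim_expr_order prim_z) expr1n.
split.
- by exists (2 * a); rewrite ?mulf_neq0 // -Q_Q'.
- exists [seq f u | u <- enum {: 'S_3 * 'Z_3}]; split=> [||g].
  + by rewrite map_inj_uniq ?enum_uniq.
  + by rewrite size_map -cardE card_prod card_Sn card_ord.
  rewrite f_im; split=> [[u <-] | /mapP[u _ ->]]; last by exists u.
  by rewrite map_f ?mem_enum.
- by exists f; split.
have -> : [:: pgl_class (M2 K); pgl_class (M3 a)] =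
    map f [:: (tperm 0 2, 0); (tperm 0 1, 2)].
  by rewrite /= M2E (pgl_class_M3 two_neq0 three_neq0 (M3_unit charK a_root)).
exact: is_generated_by_image fM f_im generated_S3_C3.
Qed.
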